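(* For $\psi\in\operatorname{Diff}(S^1)$ let $\Phi(\psi)$ be the operator on $H$ given by $\Phi(\psi)u=\psi.u$. Then $\Phi$ maps $\operatorname{Diff}(S^1)$ into $\operatorname{Sp}(\infty)$ and $\Phi:\operatorname{Diff}(S^1)\to\operatorname{Sp}(\infty)$ is a group homomorphism. Moreover, $\Phi$ is injective, but not surjective.
   Context: $\operatorname{Diff}(S^1)$ is the group (under composition) of orientation preserving $C^\infty$ diffeomorphisms of the unit circle $S^1$. $H$ is the space of complex-valued $C^\infty$ functions on $S^1$ with mean value $0$. The action of $\psi\in\operatorname{Diff}(S^1)$ on $u\in H$ is $$(\psi.u)(\theta)=u(\psi^{-1}(\theta))-\frac{1}{2\pi}\int_0^{2\pi}u(\psi^{-1}(\theta))\,d\theta .$$ On $H$ put $\omega(u,v)=\frac{1}{2\pi}\int_0^{2\pi}u v'\,d\theta$, and let $J$ be the Hilbert transformation $J e^{in\theta}=i\,\mathrm{sgn}(n)e^{in\theta}$, $n\neq0$ (extended linearly and continuously in $L^2$; it preserves $H$). The inner product on $H$ is $(u,v)_\omega=-\omega(u,J\bar v)$, equivalently $(u,v)_\omega=\sum_{n\ne0}|n|\hat u(n)\overline{\hat v(n)}$ where $\hat u(n)=\frac1{2\pi}\int_0^{2\pi}u e^{-in\theta}d\theta$; $\mathbb{H}_\omega$ is the completion of $H$ in the norm $\|\cdot\|_\omega$. $\pi^+$ and $\pi^-$ are the projections of $\mathbb{H}_\omega$ onto the closed spans of $\{e^{in\theta}:n>0\}$ and $\{e^{in\theta}:n<0\}$.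 For an operator $A$, bounded with respect to $\|\cdot\|_\omega$, the conjugate is $\bar A u=\overline{A\bar u}$, and $\|A\|_2$ denotes the Hilbert-Schmidt norm of $\pi^+A\pi^-$ (where $A$ is extended continuously to $\mathbb{H}_\omega$). $\operatorname{Sp}(\infty)$ is the set of linear operators $A:H\to H$, bounded with respect to $\|\cdot\|_\omega$, such that: (1) $A$ is invertible (as an operator on $H$); (2) $A=\bar A$; (3) $\omega(Au,Av)=\omega(u,v)$ for all $u,v$; (4) $\|A\|_2<\infty$. It is a group under composition. *)

(* Defs.v *)
From HB Require Import structures.
From mathcomp Require Import all_boot all_order all_algebra.
From mathcomp Require Import all_classical all_reals all_analysis.
From mathcomp Require Import complex.

Set Implicit Arguments.
Unset Strict Implicit.
Unset Printing Implicit Defensive.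

Import Order.TTheory GRing.Theory Num.Theory.
Import numFieldNormedType.Exports.

Local Open Scope classical_set_scope.
Local Open Scope ring_scope.
Local Open Scope complex_scope.

(* There is no topology making R[i] a normed module over R: derivatives and
   integrals of functions R -> R[i] are taken on real and imaginary parts. *)
Section ComplexValued.
Context {R : realType}.
Implicit Types f : R -> R[i].

Definition smooth_real (g : R -> R) : Prop :=
  forall (n : nat) (t : R), derivable (g^`(n))%classic t 1.

Definition smooth f : Prop :=
  smooth_real (fun t => complex.Re (f t)) /\ smooth_real (fun t => complex.Im (f t)).

Definition deriveC f (t : R) : R[i] :=
  ((fun s => complex.Re (f s))^`())%classic t +i* ((fun s => complex.Im (f s))^`())%classic t.

(* (1 / 2 pi) \int_0^{2 pi} f(t) dt *)
Definition avg f : R[i] :=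
  ((2 * pi)^-1 * \int[lebesgue_measure]_(t in `[0, 2 * pi]) complex.Re (f t)) +i*
  ((2 * pi)^-1 * \int[lebesgue_measure]_(t in `[0, 2 * pi]) complex.Im (f t)).

End ComplexValued.

Definition circle (R : realType) := {z : R[i] | `|z| == 1}.

Section Circle.
Context {R : realType}.

Lemma norm_cis (t : R) : `|cos t +i* sin t| == 1.
Proof. by rewrite normc_def /= cos2Dsin2 sqrtr1. Qed.

(* e^{i t} *)
Definition cis (t : R) : circle R := exist _ (cos t +i* sin t) (norm_cis t).

(* A function on the circle is viewed as the 2 pi-periodic function
   t |-> u (cis t) of the angle; as cis is a local diffeomorphism this
   gives the usual smooth structure of the circle. *)
Definition smooth_fun (u : circle R -> R[i]) : Prop := smooth (u \o cis).

Definition smooth_map (f : circle R -> circle R) : Prop :=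
  smooth_fun (fun z => val (f z)).

(* d/dt f(e^{it}) is a real multiple i c f(e^{it}) of the unit tangent vector
   i f(e^{it}), with c = Im (conj (f(e^{it})) d/dt f(e^{it})). *)
Definition orientation_preserving (f : circle R -> circle R) : Prop :=
  forall t : R, 0 < complex.Im ((val (f (cis t)))^* * deriveC (fun s => val (f (cis s))) t).

End Circle.

Record circle_bij (R : realType) := CircleBij {
  cb_fun :> circle R -> circle R;
  cb_inv : circle R -> circle R;
  cb_funK : cancel cb_fun cb_inv;
  cb_invK : cancel cb_inv cb_fun }.

Definition circle_bij_comp (R : realType) (f g : circle_bij R) : circle_bij R :=
  CircleBij (can_comp (cb_funK f) (cb_funK g)) (can_comp (cb_invK g) (cb_invK f)).

Definition Diff_circle (R : realType) : set (circle_bij R) :=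
  [set psi : circle_bij R | [/\ smooth_map psi, smooth_map (cb_inv psi)
               & orientation_preserving psi]].

Section SpaceH.
Context {R : realType}.
Implicit Types u v : circle R -> R[i].

Definition Hspace : set (circle R -> R[i]) :=
  [set u | smooth_fun u /\ avg (u \o cis) = 0].

Definition omega u v : R[i] :=
  avg (fun t => u (cis t) * deriveC (v \o cis) t).

Definition fourier u (n : int) : R[i] :=
  avg (fun t => u (cis t) * val (cis t) ^ (- n)).

(* Fourier coefficients identify the completion of Hspace with the sequences
   a, a 0 = 0, of finite norm; this is the squared norm there. *)
Definition sqnorm_seq (a : int -> R[i]) : \bar R :=
  \esum_(n in [set: int]) (`|n|%:~R * Normc.normc (a n) ^+ 2)%:E.

Definition sqnorm_omega u : \bar R := sqnorm_seq (fourier u).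

(* The projection pi^+ in Fourier coefficients. *)
Definition proj_pos (a : int -> R[i]) (n : int) : R[i] :=
  if 0 < n then a n else 0.

(* e^{i n theta} / sqrt |n|, n != 0: an orthonormal basis of the completion
   of Hspace, contained in Hspace. *)
Definition onb (n : int) : circle R -> R[i] :=
  fun z => ((Num.sqrt (`|n|%:~R : R))^-1)%:C * val z ^ n.

End SpaceH.

(* Operators on Hspace are functions on the ambient space, of which only the
   values on Hspace matter. *)
Definition operator (R : realType) :=
  (circle R -> R[i]) -> (circle R -> R[i]).

Section SpInfty.
Context {R : realType}.
Implicit Types A B : operator R.

Definition eq_on_H A B : Prop := forall u, Hspace u -> A u = B u.

Definition linear_on_H A : Prop :=
  forall (c : R[i]) u v, Hspace u -> Hspace v ->
    A (fun z => c * u z + v z) = (fun z => c * A u z + A v z).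

Definition bounded_on_H A : Prop :=
  exists C : R, forall u, Hspace u ->
    (sqnorm_omega (A u) <= (C ^+ 2)%:E * sqnorm_omega u)%E.

Definition conj_fun (u : circle R -> R[i]) : circle R -> R[i] :=
  fun z => (u z)^*.

Definition conj_op A : operator R := fun u => conj_fun (A (conj_fun u)).

(* Squared Hilbert-Schmidt norm of pi^+ A pi^-, as the sum of
   || pi^+ A pi^- (onb n) ||^2 over n != 0; pi^- kills onb n for n > 0 and
   fixes it for n < 0. The extension of A to the completion enters only
   through its values on onb n, which lies in Hspace. *)
Definition sqnorm_HS A : \bar R :=
  \esum_(n in [set n : int | n < 0]) sqnorm_seq (proj_pos (fourier (A (onb n)))).

Definition Sp_infty : set (operator R) :=
  [set A | [/\ set_bij Hspace Hspace A, linear_on_H A & bounded_on_H A] /\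
    [/\ eq_on_H A (conj_op A),
        (forall u v, Hspace u -> Hspace v -> omega (A u) (A v) = omega u v)
      & (sqnorm_HS A < +oo)%E]].

(* psi . u *)
Definition Phi (psi : circle_bij R) : operator R := fun u z =>
  u (cb_inv psi z) - avg (fun t => u (cb_inv psi (cis t))).

End SpInfty.

(* Main.v *)
Require Import Defs.
From mathcomp Require Import all_boot all_order all_algebra.
From mathcomp Require Import all_classical all_reals all_analysis.
From mathcomp Require Import complex ring lra zify.

(** The action of psi is composition with psi^-1 followed by a projection, so
    everything rests on a lift h of psi^-1, a smooth increasing function with
    psi^-1 (e^(i t)) = e^(i h t) and h (t + 2 pi) = h t + 2 pi
    ([inverse_lift]). Being a homomorphism, commuting with conjugation and
    bijectivity (with inverse the action of psi^-1) are formal, and omega is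
    preserved by the change of variables h ([omega_Phi]).

    The two analytic conditions have a common source. For n, m > 0 the entry
    of Phi psi between e^(- i n theta) and e^(i m theta) is the average of
    e^(- i (n h t + m t)), whose phase has derivative n h' + m bounded below
    by a multiple of n + m; two integrations by parts bound it by
    K / (n + m)^2 ([nonstationary_phase], [Phi_expz_decay]). This makes the
    block pi^+ (Phi psi) pi^- Hilbert-Schmidt ([Phi_HS]), in particular
    bounded.

    Boundedness of the whole operator then follows from symplecticity rather
    than from a direct estimate of the H^(1/2) norm. The value of
    - i omega (conj v, v) is the squared norm of the positive part of v minus
    that of its negative part, and is the same for v and for its image. If v
    has only negative frequencies, the positive part of its image is
    controlled by the block above, hence so is the negative part
    ([Phi_neg_poly_bound]). Positive frequencies follow by conjugation. The
    Fourier analysis behind this is done for trigonometric polynomials; Fejer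
    means converge uniformly ([fejer_cvg]), which gives the part of Parseval's
    identity that is used ([negative_part_le]) and the passage to arbitrary
    smooth functions ([Phi_Hsum_bound]).

    For injectivity, the image of e^(i theta) is psi^-1 minus a constant, and
    the unit circle is preserved by no nontrivial translation. For the failure
    of surjectivity, the operator that changes the sign of the modes of
    frequency 2 and -2 is symplectic, but it fixes e^(i theta) without being
    the identity ([flip2_not_Phi]). *)

Set Implicit Arguments.
Unset Strict Implicit.
Unset Printing Implicit Defensive.

Import Order.TTheory GRing.Theory Num.Theory.
Import numFieldNormedType.Exports.

Local Open Scope classical_set_scope.
Local Open Scope ring_scope.
Local Open Scope complex_scope.
Local Notation "z ^*" := (@conjc _ z) : ring_scope.

(** * Smooth real functions *)

Section RealSmooth.
Context {R : realType}.
Implicit Types f g : R -> R.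

(** Membership in C^(n+1), defined by recursion on the derivative rather than
    through the iterated derivatives, so that the Leibniz and chain rules give
    closure properties by induction. *)
Fixpoint Ck (n : nat) f : Prop :=
  (forall t, derivable f t 1) /\
  if n is n'.+1 then Ck n' (f^`())%classic else True.

Lemma smooth_realP f : smooth_real f <-> forall n, Ck n f.
Proof.
split=> [sf n|sf n].
  have: forall k, (k <= n)%N -> forall t, derivable (f^`(k))%classic t 1.
    by move=> k _; exact: sf.
  elim: n f {sf} => [|n IHn] f sf /=; first by split=> // t; apply: (sf 0%N).
  split; first exact: (sf 0%N).
  by apply: IHn => k kn t; rewrite -derive1Sn; exact: sf.
elim: n f sf => [|n IHn] f sf t; first by case: (sf 0%N) => /(_ t).
rewrite derive1Sn; apply: IHn => n'.
by case: (sf n'.+1).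
Qed.

(** Coinduction: smoothness of the members of a class of functions stable
    under derivation. *)
Lemma smooth_real_ind (P : (R -> R) -> Prop) :
  (forall f, P f -> forall t, derivable f t 1) ->
  (forall f, P f -> P (f^`())%classic) -> forall f, P f -> smooth_real f.
Proof.
move=> Pd PD f Pf; apply/smooth_realP => n.
elim: n f Pf => [|n IHn] f Pf /=; split => //; try exact: Pd.
exact/IHn/PD.
Qed.

Lemma smooth_derivable f : smooth_real f -> forall t, derivable f t 1.
Proof. by move=> sf t; exact: (sf 0%N). Qed.

Lemma smooth_is_derive f : smooth_real f ->
  forall t : R, is_derive t 1 f ((f^`())%classic t).
Proof.
by move=> sf t; rewrite derive1E; apply/derivableP/smooth_derivable.
Qed.

Lemma smooth_continuous f : smooth_real f -> continuous f.
Proof.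
move=> sf t; apply: differentiable_continuous.
by apply/derivable1_diffP/smooth_derivable.
Qed.

Lemma smooth_realD1 f : smooth_real f -> smooth_real (f^`())%classic.
Proof. by move=> sf n t; rewrite -derive1Sn; exact: sf. Qed.

Lemma derive1_eq f g : (forall t : R, is_derive t 1 f (g t)) -> (f^`())%classic = g.
Proof. by move=> fg; apply/funext => t; rewrite derive1E; case: (fg t). Qed.

Lemma CkS n f : Ck n.+1 f -> Ck n f.
Proof. by elim: n f => [|n IHn] f /= [fd fc]; split => //; apply: IHn. Qed.

Lemma derive1_add f g : (forall t, derivable f t 1) -> (forall t, derivable g t 1) ->
  ((fun t => f t + g t)^`())%classic = (fun t => (f^`())%classic t + (g^`())%classic t).
Proof.
by move=> fd gd; apply: derive1_eq => t; rewrite !derive1E;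
  apply: is_deriveD; exact: derivableP.
Qed.

Lemma derive1_opp f : (forall t, derivable f t 1) ->
  ((fun t => - f t)^`())%classic = (fun t => - (f^`())%classic t).
Proof.
by move=> fd; apply: derive1_eq => t; rewrite !derive1E;
  apply: is_deriveN; exact: derivableP.
Qed.

Lemma derive1_mul f g : (forall t, derivable f t 1) -> (forall t, derivable g t 1) ->
  ((fun t => f t * g t)^`())%classic =
  (fun t => f t * (g^`())%classic t + g t * (f^`())%classic t).
Proof.
move=> fd gd; apply: derive1_eq => t; rewrite !derive1E.
by apply: is_deriveM; exact: derivableP.
Qed.

Lemma derive1_compE f g : (forall t, derivable f t 1) -> (forall t, derivable g t 1) ->
  ((fun t => f (g t))^`())%classic = (fun t => (f^`())%classic (g t) * (g^`())%classic t).
Proof.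
move=> fd gd; apply/funext => t; exact: derive1_comp.
Qed.

Lemma smooth_ext f g : f =1 g -> smooth_real f -> smooth_real g.
Proof. by move=> /funext ->. Qed.

Lemma Ck_add n f g : Ck n f -> Ck n g -> Ck n (fun t => f t + g t).
Proof.
elim: n f g => [|n IHn] f g /= [fd fc] [gd gc]; split => //.
- by move=> t; apply: derivableD.
- by move=> t; apply: derivableD.
- by rewrite derive1_add //; exact: IHn.
Qed.

Lemma Ck_mul n f g : Ck n f -> Ck n g -> Ck n (fun t => f t * g t).
Proof.
elim: n f g => [|n IHn] f g; first by move=> [fd _] [gd _]; split => // t; apply: derivableM.
move=> sf sg; have [fd fc] := sf; have [gd gc] := sg.
split; first by move=> t; apply: derivableM.
rewrite derive1_mul //; apply: Ck_add; apply: IHn => //; exact: CkS.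
Qed.

Lemma Ck_comp n f g : Ck n f -> Ck n g -> Ck n (fun t => f (g t)).
Proof.
have dc (h k : R -> R) : (forall t, derivable h t 1) -> (forall t, derivable k t 1) ->
    forall t, derivable (fun t => h (k t)) t 1.
  move=> hd kd t; apply/derivable1_diffP.
  by apply: differentiable_comp; apply/derivable1_diffP.
elim: n f g => [|n IHn] f g; first by move=> [fd _] [gd _]; split => //; apply: dc.
move=> sf sg; have [fd fc] := sf; have [gd gc] := sg.
split; first exact: dc.
rewrite derive1_compE //; apply: Ck_mul => //; apply: IHn => //; exact: CkS.
Qed.

Lemma smooth_add f g : smooth_real f -> smooth_real g ->
  smooth_real (fun t => f t + g t).
Proof.
by move=> /smooth_realP sf /smooth_realP sg; apply/smooth_realP => n; apply: Ck_add.
Qed.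

Lemma smooth_mul f g : smooth_real f -> smooth_real g ->
  smooth_real (fun t => f t * g t).
Proof.
by move=> /smooth_realP sf /smooth_realP sg; apply/smooth_realP => n; apply: Ck_mul.
Qed.

Lemma smooth_comp f g : smooth_real f -> smooth_real g ->
  smooth_real (fun t => f (g t)).
Proof.
by move=> /smooth_realP sf /smooth_realP sg; apply/smooth_realP => n; apply: Ck_comp.
Qed.

Lemma smooth_cst (c : R) : smooth_real (fun=> c).
Proof.
apply: (smooth_real_ind (P := fun f => exists c, f = fun=> c)); last by exists c.
  by move=> f [d ->] t; apply: derivable_cst.
by move=> f [d ->]; exists 0; apply/derive1_eq => t; apply: is_derive_cst.
Qed.

Arguments smooth_cst : clear implicits.

Lemma smooth_opp f : smooth_real f -> smooth_real (fun t => - f t).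
Proof.
move=> sf; apply: (@smooth_ext (fun t => (-1) * f t)) => [t|]; first by rewrite mulN1r.
by apply: smooth_mul => //; exact: smooth_cst.
Qed.

Lemma smooth_sub f g : smooth_real f -> smooth_real g ->
  smooth_real (fun t => f t - g t).
Proof. by move=> sf sg; exact (smooth_add sf (smooth_opp sg)). Qed.

Lemma derive1_idE : ((fun t : R => t)^`())%classic = fun=> 1.
Proof. by apply/derive1_eq => t; apply: is_derive_id. Qed.

Lemma derive1_addc f (a : R) : (forall t, derivable f t 1) ->
  ((fun t => f t + a)^`())%classic = (f^`())%classic.
Proof.
move=> fd; apply: derive1_eq => t; rewrite derive1E.
by have := is_deriveD (derivableP (fd t)) (is_derive_cst a t 1); rewrite addr0.
Qed.

Lemma derive1_shift (a : R) : ((fun t : R => t + a)^`())%classic = fun=> 1.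
Proof.
by rewrite -derive1_idE (derive1_addc (f := fun t => t)) // => t; exact: derivable_id.
Qed.

Lemma smooth_id : smooth_real (fun t : R => t).
Proof.
apply/smooth_realP => -[|n] /=; split => //.
by rewrite derive1_idE; move: n; apply/smooth_realP/smooth_cst.
Qed.

Arguments smooth_id : clear implicits.

Lemma smooth_shift (a : R) : smooth_real (fun t : R => t + a).
Proof. exact (smooth_add smooth_id (smooth_cst a)). Qed.

Lemma smooth_trig : smooth_real (@cos R) /\ smooth_real (@sin R).
Proof.
pose P f := exists a b : R, f = fun t => a * cos t + b * sin t.
suff H f : P f -> smooth_real f.
  split; apply: H.
    by exists 1, 0; apply/funext => t; rewrite mul1r mul0r addr0.
  by exists 0, 1; apply/funext => t; rewrite mul1r mul0r add0r.
have D (a b : R) (t : R) : is_derive t 1 (fun t : R => a * cos t + b * sin t)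
    (b * cos t + (- a) * sin t).
  apply: is_derive_eq; rewrite /GRing.scale /=. ring.
apply: smooth_real_ind => {}f [a [b ->]].
  by move=> t; case: (D a b t).
by exists b, (- a); apply/derive1_eq.
Qed.

Lemma smooth_cos : smooth_real (@cos R). Proof. by case: smooth_trig. Qed.
Lemma smooth_sin : smooth_real (@sin R). Proof. by case: smooth_trig. Qed.

Lemma smooth_inv f : (forall t, f t != 0) -> smooth_real f ->
  smooth_real (fun t => (f t)^-1).
Proof.
move=> f0 sf; apply/smooth_realP => n; move/smooth_realP : (sf) => cf.
have fd := smooth_derivable sf.
have D : ((fun t => (f t)^-1)^`())%classic =
    (fun t => - (f^`())%classic t * ((f t)^-1 * (f t)^-1)).
  apply/derive1_eq => t; have := derivableP (fd t) => H.
  have := @is_deriveV R f t _ 1 (f0 t) H.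
  move/is_derive_eq; apply; rewrite /GRing.scale /= -derive1E expr2 invfM; ring.
elim: n => [|n IHn]; split => //; try (by move=> t; apply: derivableV).
rewrite D; apply: Ck_mul; last by apply: Ck_mul.
by move: n {IHn}; apply/smooth_realP/smooth_opp/smooth_realD1.
Qed.

End RealSmooth.
Arguments smooth_cst {R} c.
Arguments smooth_id {R}.
Arguments smooth_cos {R}.
Arguments smooth_sin {R}.
Arguments smooth_shift {R} a.

(** * Integrals, primitives and mean value estimates *)

Section RealIntegral.
Context {R : realType}.
Implicit Types f g : R -> R.
Local Notation mu := (@lebesgue_measure R).

Lemma smooth_within f (A : set R) : smooth_real f -> {within A, continuous f}.
Proof. by move=> sf; apply: continuous_subspaceT; exact: smooth_continuous. Qed.

Lemma smooth_integrable f (a b : R) : smooth_real f ->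
  mu.-integrable `[a, b] (EFin \o f).
Proof.
move=> sf; apply: continuous_compact_integrable; first exact: segment_compact.
exact: smooth_within.
Qed.

Lemma smooth_eq_cst f : (forall t : R, is_derive t 1 f 0) -> forall s t, f s = f t.
Proof. by move=> df s t; exact: is_derive_0_is_cst. Qed.

(** Integration from a gives a primitive on the half-line ]a, +oo[; normalized
    to vanish at 0 it does not depend on a, so these primitives glue to one
    on the whole line. *)
Lemma smooth_primitive f : smooth_real f ->
  exists2 F, smooth_real F & (F^`())%classic = f.
Proof.
move=> sf.
pose I a t := \int[mu]_(x in `[a, t]) f x.
pose P a t := I a t - I a 0.
have PE (a b t : R) : a <= b -> b <= t -> b <= 0 -> P a t = P b t.
  move=> ab bt b0; rewrite /P.
  have E s : b <= s -> I a s = I a b + I b s.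
    move=> bs; apply/eqP; rewrite addrC -subr_eq; apply/eqP.
    rewrite /I Rintegral_itvB ?bnd_simp //; last exact: smooth_integrable.
    rewrite Rintegral_itv_obnd_cbnd //.
    apply: (integrableS _ _ _ (smooth_integrable b s sf)) => //=.
    by apply: subset_itvr; rewrite bnd_simp.
  rewrite (E t bt) (E 0 b0); ring.
have PD (a t : R) : a < t -> is_derive t 1 (P a) (f t).
  move=> a_t.
  have [] := @continuous_FTC1_closed R f a t (t + 1); rewrite ?ltrDl //.
  - exact: smooth_integrable.
  - exact: smooth_continuous.
  move=> d e; have := derivableP d; rewrite -derive1E e => H.
  rewrite (_ : P a = (fun t => I a t + - I a 0)) //.
  have := is_deriveD H (is_derive_cst (- I a 0) t 1).
  by rewrite addr0.
pose F t := P (- (`|t| + 1)) t.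
have FD (t : R) : is_derive t 1 F (f t).
  apply: (@near_eq_is_derive R R R (P (- (`|t| + 2)))); last first.
    by apply: PD; rewrite ltrNl -normrN (le_lt_trans (ler_norm _)) // ltrDl.
  near=> s.
  have st : `|s| < `|t| + 1.
    have : `|t - s| < 1 by near: s; exact: nbhsx_ballx.
    move=> ts; have := ler_normD t (s - t); rewrite addrC subrK distrC.
    by move=> /le_lt_trans; apply; rewrite ltrD2l.
  have sN : - `|s| <= s by rewrite lerNl -normrN ler_norm.
  have s0 := normr_ge0 s.
  by apply: PE; lra.
exists F; last exact: derive1_eq.
move=> [|n] t; first by case: (FD t).
by rewrite derive1Sn (derive1_eq FD); exact: sf.
Unshelve. all: by end_near. Qed.

Lemma Rintegral_derive1 F (a b : R) : a < b -> smooth_real F ->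
  \int[mu]_(x in `[a, b]) (F^`())%classic x = F b - F a.
Proof.
move=> ab sF; rewrite /Rintegral (@continuous_FTC2 _ _ F a b) //.
- exact/smooth_within/smooth_realD1.
- split.
  + by move=> t _; exact: smooth_derivable.
  + exact/cvg_at_right_filter/smooth_continuous.
  + exact/cvg_at_left_filter/smooth_continuous.
Qed.

Lemma smooth_bounded f (a b : R) : a <= b -> smooth_real f ->
  exists2 M : R, 0 < M & forall t, a <= t <= b -> `|f t| <= M.
Proof.
move=> ab sf; have cf := @smooth_within _ [set` `[a, b]] sf.
have [x _ xM] := EVT_max ab cf.
have [y _ yM] := EVT_min ab cf.
exists (`|f x| + `|f y| + 1); first by rewrite ltr_wpDl // addr_ge0.
move=> t atb; have tab : t \in `[a, b] by rewrite in_itv.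
have := xM _ tab; have := yM _ tab.
have := ler_norm (f x); have := ler_norm (- f y); rewrite normrN.
rewrite ler_norml; have := normr_ge0 (f x); have := normr_ge0 (f y); lra.
Qed.

Lemma smooth_pos_min f (a b : R) : a <= b -> smooth_real f -> (forall t, 0 < f t) ->
  exists2 c : R, 0 < c & forall t, a <= t <= b -> c <= f t.
Proof.
move=> ab sf f0; have [y _ yM] := EVT_min ab (@smooth_within _ [set` `[a, b]] sf).
by exists (f y) => // t atb; apply: yM; rewrite in_itv.
Qed.

Lemma smooth_lipschitz f (a b M : R) : smooth_real f ->
  (forall t, a <= t <= b -> `|(f^`())%classic t| <= M) ->
  forall s t, a <= s <= b -> a <= t <= b -> `|f t - f s| <= M * `|t - s|.
Proof.
move=> sf fM; suff H s t : s <= t -> a <= s <= b -> a <= t <= b ->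
    `|f t - f s| <= M * `|t - s|.
  move=> s t sab tab; have [st|/ltW ts] := leP s t; first exact: H.
  by rewrite distrC (distrC t); apply: H.
move=> st /andP[as_ sb] /andP[at_ tb].
have [x] := @MVT_segment R f (f^`())%classic s t st
  (fun x _ => smooth_is_derive sf x) (@smooth_within _ _ sf).
rewrite in_itv /= => /andP[sx xt] ->.
by rewrite normrM ler_wpM2r // fM // (le_trans as_ sx) (le_trans xt tb).
Qed.

Lemma smooth_increasing f : smooth_real f -> (forall t, 0 < (f^`())%classic t) ->
  forall s t, s < t -> f s < f t.
Proof.
move=> sf f0 s t st; have [x _ e] := @MVT_segment R f (f^`())%classic s t (ltW st)
  (fun x _ => smooth_is_derive sf x) (@smooth_within _ _ sf).
by rewrite -subr_gt0 e mulr_gt0 // subr_gt0.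
Qed.

End RealIntegral.

(** * Complex numbers and smooth complex-valued functions *)

Section ComplexCalculus.
Context {R : realType}.
Implicit Types (f g : R -> R[i]) (h : R -> R) (z w : R[i]).
Local Notation Re := (@complex.Re R).
Local Notation Im := (@complex.Im R).
Local Notation normc := (@Normc.normc R).
Local Notation mu := (@lebesgue_measure R).

Lemma ReD z w : Re (z + w) = Re z + Re w. Proof. by case: z w => [? ?] []. Qed.
Lemma ImD z w : Im (z + w) = Im z + Im w. Proof. by case: z w => [? ?] []. Qed.
Lemma ReN z : Re (- z) = - Re z. Proof. by case: z. Qed.
Lemma ImN z : Im (- z) = - Im z. Proof. by case: z. Qed.
Lemma ReM z w : Re (z * w) = Re z * Re w - Im z * Im w.
Proof. by case: z w => [? ?] []. Qed.
Lemma ImM z w : Im (z * w) = Re z * Im w + Im z * Re w.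
Proof. by case: z w => [? ?] []. Qed.
Lemma ReJ z : Re z^* = Re z. Proof. by case: z. Qed.
Lemma ImJ z : Im z^* = - Im z. Proof. by case: z. Qed.
Definition ReImE := (ReD, ImD, ReN, ImN, ReM, ImM, ReJ, ImJ).

Lemma complexP z w : Re z = Re w -> Im z = Im w -> z = w.
Proof. by case: z w => [a b] [c d] /= -> ->. Qed.

Lemma normc_sqr z : normc z ^+ 2 = Re z ^+ 2 + Im z ^+ 2.
Proof. by case: z => a b; rewrite sqr_sqrtr // addr_ge0 // sqr_ge0. Qed.

Lemma normc_ge0 z : 0 <= normc z.
Proof. by case: z => a b; exact: sqrtr_ge0. Qed.

Lemma Re_le_normc z : Re z <= normc z.
Proof.
apply: (le_trans (ler_norm _)); rewrite -(ler_pXn2r (ltn0Sn 1)) ?nnegrE ?normc_ge0 //.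
by rewrite normc_sqr real_normK ?num_real // lerDl sqr_ge0.
Qed.

Lemma Im_le_normc z : Im z <= normc z.
Proof.
apply: (le_trans (ler_norm _)); rewrite -(ler_pXn2r (ltn0Sn 1)) ?nnegrE ?normc_ge0 //.
by rewrite normc_sqr real_normK ?num_real // lerDr sqr_ge0.
Qed.

Lemma mulcJ z : z^* * z = (normc z ^+ 2)%:C.
Proof. by rewrite normc_sqr; apply: complexP; rewrite ReImE /= ReJ ImJ; ring. Qed.

Lemma normcJ z : normc z^* = normc z.
Proof. by case: z => a b /=; rewrite sqrrN. Qed.

Lemma normc_real (x : R) : normc x%:C = `|x|.
Proof. by rewrite /= expr0n addr0 sqrtr_sqr. Qed.

Lemma natC n : (n%:R)%:C = n%:R :> R[i]. Proof. exact: rmorph_nat. Qed.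

Lemma conjcM z w : (z * w)^* = z^* * w^*. Proof. exact: rmorphM. Qed.
Lemma conjcB z w : (z - w)^* = z^* - w^*. Proof. exact: rmorphB. Qed.
Lemma conjcD z w : (z + w)^* = z^* + w^*. Proof. exact: rmorphD. Qed.

Lemma conjc_sum (I : Type) (r : seq I) (P : pred I) (F : I -> R[i]) :
  (\sum_(i <- r | P i) F i)^* = \sum_(i <- r | P i) (F i)^*.
Proof. exact: raddf_sum. Qed.

Lemma normc_add z w : normc (z + w) <= normc z + normc w.
Proof. exact: le_normcD. Qed.

Lemma normcB z w : normc (z - w) = normc (w - z).
Proof. by rewrite -normcN opprB. Qed.

(** * Smooth complex-valued functions of a real variable *)

Lemma smoothC_cst z : smooth (fun=> z).
Proof. by split; exact: smooth_cst. Qed.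

Lemma smoothC_add f g : smooth f -> smooth g -> smooth (fun t => f t + g t).
Proof.
move=> [fr fi] [gr gi]; split.
  by apply: (smooth_ext _ (smooth_add fr gr)) => t /=; rewrite ReD.
by apply: (smooth_ext _ (smooth_add fi gi)) => t /=; rewrite ImD.
Qed.

Lemma smoothC_opp f : smooth f -> smooth (fun t => - f t).
Proof.
move=> [fr fi]; split.
  by apply: (smooth_ext _ (smooth_opp fr)) => t /=; rewrite ReN.
by apply: (smooth_ext _ (smooth_opp fi)) => t /=; rewrite ImN.
Qed.

Lemma smoothC_sub f g : smooth f -> smooth g -> smooth (fun t => f t - g t).
Proof. by move=> sf sg; exact (smoothC_add sf (smoothC_opp sg)). Qed.

Lemma smoothC_mul f g : smooth f -> smooth g -> smooth (fun t => f t * g t).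
Proof.
move=> [fr fi] [gr gi]; split.
  apply: (smooth_ext _ (smooth_sub (smooth_mul fr gr) (smooth_mul fi gi))) => t.
  by rewrite ReM.
apply: (smooth_ext _ (smooth_add (smooth_mul fr gi) (smooth_mul fi gr))) => t.
by rewrite ImM.
Qed.

Lemma smoothC_conj f : smooth f -> smooth (fun t => (f t)^*).
Proof.
move=> [fr fi]; split.
  by apply: (smooth_ext _ fr) => t; rewrite ReJ.
by apply: (smooth_ext _ (smooth_opp fi)) => t; rewrite ImJ.
Qed.

Lemma smoothC_comp f h : smooth f -> smooth_real h -> smooth (fun t => f (h t)).
Proof. by move=> [fr fi] sh; exact (conj (smooth_comp fr sh) (smooth_comp fi sh)). Qed.

Lemma smoothC_real h : smooth_real h -> smooth (fun t => (h t)%:C).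
Proof. by move=> sh; exact (conj sh (smooth_cst 0)). Qed.

Lemma smoothC_sum (I : Type) (r : seq I) (P : pred I) (F : I -> R -> R[i]) :
  (forall i, P i -> smooth (F i)) -> smooth (fun t => \sum_(i <- r | P i) F i t).
Proof.
move=> sF; rewrite (_ : (fun t => _) = \sum_(i <- r | P i) F i); last first.
  by apply/funext => t; rewrite fct_sumE.
elim/big_rec: _ => [|i f Pi sf]; first exact (smoothC_cst 0).
exact (smoothC_add (sF i Pi) sf).
Qed.

Lemma smoothC_deriveC f : smooth f -> smooth (deriveC f).
Proof. by move=> [fr fi]; split; exact: smooth_realD1. Qed.

Lemma deriveC_add f g : smooth f -> smooth g ->
  deriveC (fun t => f t + g t) = (fun t => deriveC f t + deriveC g t).
Proof.
move=> [fr fi] [gr gi]; apply/funext => t; apply: complexP; rewrite ReImE /=.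
  under [X in (X^`())%classic]funext => s do rewrite ReD.
  by rewrite (derive1_add (smooth_derivable fr) (smooth_derivable gr)).
under [X in (X^`())%classic]funext => s do rewrite ImD.
by rewrite (derive1_add (smooth_derivable fi) (smooth_derivable gi)).
Qed.

Lemma deriveC_mul f g : smooth f -> smooth g ->
  deriveC (fun t => f t * g t) = (fun t => deriveC f t * g t + f t * deriveC g t).
Proof.
move=> [fr fi] [gr gi]; apply/funext => t; apply: complexP; rewrite !ReImE /=.
  under [X in (X^`())%classic]funext => s do rewrite ReM.
  have s1 := smooth_mul fr gr; have s2 := smooth_mul fi gi.
  rewrite (derive1_add (smooth_derivable s1) (smooth_derivable (smooth_opp s2))).
  rewrite (derive1_opp (smooth_derivable s2)).
  rewrite (derive1_mul (smooth_derivable fr) (smooth_derivable gr)).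
  rewrite (derive1_mul (smooth_derivable fi) (smooth_derivable gi)).
  ring.
under [X in (X^`())%classic]funext => s do rewrite ImM.
have s1 := smooth_mul fr gi; have s2 := smooth_mul fi gr.
rewrite (derive1_add (smooth_derivable s1) (smooth_derivable s2)).
rewrite (derive1_mul (smooth_derivable fr) (smooth_derivable gi)).
rewrite (derive1_mul (smooth_derivable fi) (smooth_derivable gr)).
ring.
Qed.

Lemma deriveC_cst z : deriveC (fun=> z) = fun=> 0.
Proof. by apply/funext => t; rewrite /deriveC !derive1_cst. Qed.

Lemma deriveC_scale z f : smooth f ->
  deriveC (fun t => z * f t) = (fun t => z * deriveC f t).
Proof.
move=> sf; rewrite (deriveC_mul (smoothC_cst z) sf).
by apply/funext => t; rewrite deriveC_cst mul0r add0r.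
Qed.

Lemma deriveC_sub f g : smooth f -> smooth g ->
  deriveC (fun t => f t - g t) = (fun t => deriveC f t - deriveC g t).
Proof.
move=> sf sg; rewrite (deriveC_add sf (smoothC_opp sg)); apply/funext => t.
congr (_ + _); have := congr1 (fun k => k t) (deriveC_scale (-1) sg).
by rewrite mulN1r => <-; congr (deriveC _ t); apply/funext => s; rewrite mulN1r.
Qed.

Lemma deriveC_conj f : smooth f ->
  deriveC (fun t => (f t)^*) = (fun t => (deriveC f t)^*).
Proof.
move=> [fr fi]; apply/funext => t; apply: complexP; rewrite !ReImE /=.
  by under [X in (X^`())%classic]funext => s do rewrite ReJ.
under [X in (X^`())%classic]funext => s do rewrite ImJ.
by rewrite (derive1_opp (smooth_derivable fi)).
Qed.

Lemma deriveC_comp f h : smooth f -> smooth_real h ->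
  deriveC (fun t => f (h t)) = (fun t => ((h^`())%classic t)%:C * deriveC f (h t)).
Proof.
move=> [fr fi] sh; apply/funext => t; apply: complexP; rewrite !ReImE /=.
  rewrite (derive1_compE (smooth_derivable fr) (smooth_derivable sh)).
  by rewrite mul0r subr0 mulrC.
rewrite (derive1_compE (smooth_derivable fi) (smooth_derivable sh)).
by rewrite mul0r addr0 mulrC.
Qed.

Lemma deriveC_real h : smooth_real h ->
  deriveC (fun t => (h t)%:C) = (fun t => ((h^`())%classic t)%:C).
Proof. by move=> sh; apply/funext => t; rewrite /deriveC /= derive1_cst. Qed.

Lemma deriveC_eq0 f : smooth f -> deriveC f = (fun=> 0) -> forall s t, f s = f t.
Proof.
move=> [fr fi] df s t.
have d0 r : deriveC f r = 0 by rewrite df.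
apply: complexP.
  apply: (@smooth_eq_cst _ (fun s => Re (f s))) => r.
  by have := smooth_is_derive fr r; case: (d0 r) => -> _.
apply: (@smooth_eq_cst _ (fun s => Im (f s))) => r.
by have := smooth_is_derive fi r; case: (d0 r) => _ ->.
Qed.

Lemma smoothC_primitive f : smooth f -> exists2 F, smooth F & deriveC F = f.
Proof.
move=> [/smooth_primitive [F sF dF] /smooth_primitive [G sG dG]].
exists (fun t => F t +i* G t) => //; apply/funext => t.
by rewrite /deriveC /= dF dG; case: (f t).
Qed.

(** * Averages *)

Lemma twopi_gt0 : 0 < 2 * pi :> R. Proof. by rewrite mulr_gt0 // pi_gt0. Qed.

Lemma twopi_neq0 : 2 * pi != 0 :> R. Proof. by rewrite gt_eqF // twopi_gt0. Qed.

(** Every smooth function is a derivative, so the linearity of averages below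
    reduces to the fundamental theorem of calculus, without integrability
    conditions. *)
Lemma avg_deriveC f : smooth f ->
  avg (deriveC f) = ((2 * pi)^-1)%:C * (f (2 * pi) - f 0).
Proof.
move=> [fr fi]; rewrite /avg /= (Rintegral_derive1 twopi_gt0 fr).
rewrite (Rintegral_derive1 twopi_gt0 fi).
by apply: complexP; rewrite !ReImE /= mul0r ?subr0 ?addr0.
Qed.

Lemma avgD f g : smooth f -> smooth g ->
  avg (fun t => f t + g t) = avg f + avg g.
Proof.
move=> /smoothC_primitive[F sF <-] /smoothC_primitive[G sG <-].
rewrite -(deriveC_add sF sG) (avg_deriveC sF) (avg_deriveC sG).
rewrite (avg_deriveC (smoothC_add sF sG)).
ring.
Qed.

Lemma avgZ z f : smooth f -> avg (fun t => z * f t) = z * avg f.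
Proof.
move=> /smoothC_primitive[F sF <-].
rewrite -(deriveC_scale z sF) (avg_deriveC sF).
rewrite (avg_deriveC (smoothC_mul (smoothC_cst z) sF)).
ring.
Qed.

Lemma avgZr z f : smooth f -> avg (fun t => f t * z) = avg f * z.
Proof. by move=> sf; under eq_fun do rewrite mulrC; rewrite avgZ // mulrC. Qed.

Lemma avg_cst z : avg (fun=> z : R[i]) = z.
Proof.
pose F t := z * (t%:C : R[i]).
have si := smoothC_real (smooth_id).
have dF : deriveC F = fun=> z.
  rewrite (deriveC_scale z si) (deriveC_real (smooth_id)).
  by apply/funext => t; rewrite derive1_idE mulr1.
rewrite -dF (avg_deriveC (smoothC_mul (smoothC_cst z) si)).
by rewrite /F -mulrBr subr0 mulrCA -rmorphM /= mulVf ?mulr1 // twopi_neq0.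
Qed.

Lemma avgN f : smooth f -> avg (fun t => - f t) = - avg f.
Proof.
by move=> sf; rewrite -mulN1r -(avgZ _ sf); congr avg; apply/funext => t; rewrite mulN1r.
Qed.

Lemma avgB f g : smooth f -> smooth g ->
  avg (fun t => f t - g t) = avg f - avg g.
Proof. by move=> sf sg; rewrite (avgD sf (smoothC_opp sg)) (avgN sg). Qed.

Lemma avg_sum (I : Type) (r : seq I) (P : pred I) (F : I -> R -> R[i]) :
  (forall i, P i -> smooth (F i)) ->
  avg (fun t => \sum_(i <- r | P i) F i t) = \sum_(i <- r | P i) avg (F i).
Proof.
move=> sF; elim: r => [|i r IHr].
  rewrite big_nil -[RHS]avg_cst; congr avg; apply/funext => t.
  by rewrite big_nil.
rewrite big_cons -IHr; case: ifP => Pi.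
  rewrite -(avgD (sF i Pi) (smoothC_sum r sF)).
  by congr avg; apply/funext => t; rewrite big_cons Pi.
by congr avg; apply/funext => t; rewrite big_cons Pi.
Qed.

Lemma avg_conj f : smooth f -> avg (fun t => (f t)^*) = (avg f)^*.
Proof.
move=> /smoothC_primitive[F sF <-].
rewrite -(deriveC_conj sF) (avg_deriveC sF) (avg_deriveC (smoothC_conj sF)).
by apply: complexP; rewrite !ReImE /=; ring.
Qed.

Lemma avg_Re_le f g : smooth f -> smooth g ->
  (forall t, 0 <= t <= 2 * pi -> Re (f t) <= Re (g t)) -> Re (avg f) <= Re (avg g).
Proof.
move=> [fr _] [gr _] fg /=; rewrite ler_pM2l ?invr_gt0 ?twopi_gt0 //.
apply: (le_Rintegral _ (smooth_integrable _ _ fr) (smooth_integrable _ _ gr)) => //.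
Qed.

Lemma normc_avg_le f h : smooth f -> smooth_real h ->
  (forall t, 0 <= t <= 2 * pi -> normc (f t) <= h t) ->
  normc (avg f) <= Re (avg (fun t => (h t)%:C)).
Proof.
move=> sf sh fh; set z := avg f; set A := avg _.
have sH := smoothC_real sh.
(* Multiplying f by the conjugate of its average reduces to real parts. *)
have : normc z * normc z <= normc z * Re A.
  rewrite -expr2 -[leLHS]/(Re (normc z ^+ 2)%:C) -mulcJ /z -(avgZ _ sf) -/z.
  have -> : normc z * Re A = Re ((normc z)%:C * A) by rewrite ReM /= mul0r subr0.
  rewrite /A -(avgZ _ sH).
  apply: (avg_Re_le (smoothC_mul (smoothC_cst _) sf) (smoothC_mul (smoothC_cst _) sH)).
  move=> t t2; apply: (le_trans (Re_le_normc _)).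
  by rewrite Normc.normcM normcJ ReM /= mul0r subr0 ler_wpM2l ?normc_ge0 ?fh.
have := normc_ge0 z; rewrite le_eqVlt => /orP[/eqP <- _|z0]; last by rewrite ler_pM2l.
rewrite -[leLHS]/(Re 0) -(avg_cst 0); apply: (avg_Re_le (smoothC_cst 0) sH).
by move=> t /fh /=; apply: le_trans; exact: normc_ge0.
Qed.

Lemma normc_avg_le_cst f (M : R) : smooth f ->
  (forall t, 0 <= t <= 2 * pi -> normc (f t) <= M) -> normc (avg f) <= M.
Proof.
move=> sf fM; have := normc_avg_le sf (smooth_cst M) fM.
by rewrite avg_cst.
Qed.

End ComplexCalculus.

(** * The exponential map and lifts of circle maps *)

Section Lifts.
Context {R : realType}.
Implicit Types (f g : R -> R[i]) (h : R -> R) (z w : R[i]) (s t : R).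
Local Notation Re := (@complex.Re R).
Local Notation Im := (@complex.Im R).
Local Notation normc := (@Normc.normc R).

Definition expi t : R[i] := cos t +i* sin t.

Lemma val_cis t : val (cis t) = expi t. Proof. by []. Qed.

Lemma expiD s t : expi (s + t) = expi s * expi t.
Proof. by apply: complexP; rewrite ReImE /= ?cosD ?sinD; ring. Qed.

Lemma expi0 : expi 0 = 1. Proof. by rewrite /expi cos0 sin0. Qed.

Lemma expiN t : expi (- t) = (expi t)^*.
Proof. by rewrite /expi cosN sinN. Qed.

Lemma normc_expi t : normc (expi t) = 1.
Proof. by rewrite /= cos2Dsin2 sqrtr1. Qed.

Lemma expi_neq0 t : expi t != 0.
Proof. by apply/eqP => e; have := normc_expi t; rewrite e Normc.normc0 => /esym/eqP; rewrite oner_eq0. Qed.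

Lemma expiV t : expi (- t) = (expi t)^-1.
Proof.
by apply: (mulIf (expi_neq0 t)); rewrite -expiD addNr expi0 mulVf // expi_neq0.
Qed.

Lemma expiX n t : expi t ^+ n = expi (n%:R * t).
Proof.
elim: n => [|n IHn]; first by rewrite mul0r expi0.
by rewrite exprS IHn -expiD; congr expi; rewrite -natr1; ring.
Qed.

Lemma expi_exprz (n : int) t : expi t ^ n = expi (n%:~R * t).
Proof.
case: n => n; first exact: expiX.
by rewrite NegzE -exprnN expiX -expiV; congr expi; rewrite mulrNz mulNr.
Qed.

Lemma expi_periodic t : expi (t + 2 * pi) = expi t.
Proof. by rewrite /expi mulr_natl cosD2pi sinD2pi. Qed.

Lemma expi_eq1 t : 0 < t < 2 * pi -> expi t != 1.
Proof.
move=> /andP[t0 t2]; apply/eqP => e.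
have c1 : cos t = 1 by move: e => /(congr1 Re).
have : 0 < sin (t / 2) by apply: sin_gt0_pi; rewrite divr_gt0 //= ltr_pdivrMr // mulrC.
have : sin (t / 2) ^+ 2 = 0.
  have := c1; rewrite {1}(_ : t = t / 2 *+ 2); last by rewrite -mulr_natl; field.
  rewrite cos_mulr2n => H; have := cos2Dsin2 (t / 2); lra.
by move/eqP; rewrite sqrf_eq0 => /eqP ->; rewrite ltxx.
Qed.

Lemma expi_surj_semicircle z : normc z = 1 -> 0 <= Im z ->
  exists2 t, 0 <= t <= pi & expi t = z.
Proof.
move=> z1 z0; have e : Re z ^+ 2 + Im z ^+ 2 = 1 by rewrite -normc_sqr z1 expr1n.
have r1 : -1 <= Re z <= 1.
  rewrite -ler_norml -(ler_pXn2r (ltn0Sn 1)) ?nnegrE //.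
  by rewrite expr1n real_normK ?num_real // -e lerDl sqr_ge0.
exists (acos (Re z)); first by rewrite acos_ge0 // acos_lepi.
apply: complexP => /=; first by rewrite acosK // in_itv.
rewrite sin_acos //; apply: (pexpIrn (ltn0Sn 1)); rewrite ?nnegrE ?sqrtr_ge0 //.
rewrite sqr_sqrtr; first by lra.
by rewrite -e addrC addKr sqr_ge0.
Qed.

Lemma expi_surj z : normc z = 1 -> exists2 t, 0 <= t <= 2 * pi & expi t = z.
Proof.
move=> z1; have pi0 := @pi_gt0 R; have [z0|z0] := leP 0 (Im z).
  have [t /andP[t0 tp] <-] := expi_surj_semicircle z1 z0.
  by exists t => //; apply/andP; split; lra.
have [||t /andP[t0 tp] tz] := @expi_surj_semicircle (z^*); rewrite ?normcJ ?ImJ //.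
  by rewrite oppr_ge0 ltW.
exists (2 * pi - t); first by apply/andP; split; lra.
by rewrite addrC expi_periodic expiN tz conjcK.
Qed.

Lemma normc_circle (c : circle R) : normc (val c) = 1.
Proof. by case: c => z /= /eqP e; have := e; case=> /= ->. Qed.

Lemma cis_surj (c : circle R) : exists2 t, 0 <= t <= 2 * pi & cis t = c.
Proof.
have [t t2 tc] := expi_surj (normc_circle c).
by exists t => //; apply: val_inj.
Qed.

Lemma cisE s t : expi s = expi t -> cis s = cis t.
Proof. by move=> st; apply: val_inj. Qed.

Lemma cis_periodic t : cis (t + 2 * pi) = cis t.
Proof. exact/cisE/expi_periodic. Qed.

Lemma smooth_expi : smooth expi.
Proof. by split; [exact: smooth_cos|exact: smooth_sin]. Qed.

Lemma smooth_expi_comp h : smooth_real h -> smooth (fun t => expi (h t)).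
Proof. exact/smoothC_comp/smooth_expi. Qed.

Lemma smooth_expi_linear (a : R) : smooth (fun t => expi (a * t)).
Proof. exact (smooth_expi_comp (smooth_mul (smooth_cst a) smooth_id)). Qed.

Lemma deriveC_expi : deriveC expi = (fun t => 'i * expi t).
Proof.
apply/funext => t; rewrite /deriveC /=; apply: complexP; rewrite !ReImE /=.
  by rewrite derive1E derive_val mul0r mul1r sub0r.
by rewrite derive1E derive_val mul0r mul1r add0r.
Qed.

Lemma deriveC_expi_comp h : smooth_real h ->
  deriveC (fun t => expi (h t)) = (fun t => 'i * ((h^`())%classic t)%:C * expi (h t)).
Proof.
move=> sh; rewrite (deriveC_comp smooth_expi sh) deriveC_expi.
by apply/funext => t; ring.
Qed.

Lemma derive1_linear (a : R) : ((fun t : R => a * t)^`())%classic = fun=> a.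
Proof.
by apply: derive1_eq => t; apply: is_derive_eq; rewrite /GRing.scale /= mulr1.
Qed.

Lemma deriveC_expi_linear (a : R) :
  deriveC (fun t => expi (a * t)) = (fun t => 'i * a%:C * expi (a * t)).
Proof.
by rewrite (deriveC_expi_comp (smooth_mul (smooth_cst a) (smooth_id))) derive1_linear.
Qed.

(** The angle is recovered as a primitive of Im (f^* f'): with this choice
    f * exp (- i h) has derivative zero. *)
Lemma lift_exists f : smooth f -> (forall t, normc (f t) = 1) ->
  exists2 h, smooth_real h & forall t, f t = expi (h t).
Proof.
move=> sf f1.
have sc := smoothC_mul (smoothC_conj sf) (smoothC_deriveC sf).
pose c t := Im ((f t)^* * deriveC f t).
have [h0 sh0 dh0] := smooth_primitive (proj2 sc : smooth_real c).
have [a _ a0] := expi_surj (f1 0).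
pose h t := h0 t + (a - h0 0).
have sh : smooth_real h := smooth_add sh0 (smooth_cst _).
have dh : (h^`())%classic = c by rewrite -dh0 (derive1_addc _ (smooth_derivable sh0)).
have unit_f t : Re (f t) ^+ 2 + Im (f t) ^+ 2 = 1 by rewrite -normc_sqr f1 expr1n.
have tangent t : Re (f t) * Re (deriveC f t) + Im (f t) * Im (deriveC f t) = 0.
  have := deriveC_mul (smoothC_conj sf) sf; rewrite (deriveC_conj sf).
  under eq_fun do rewrite mulcJ f1.
  rewrite deriveC_cst => /(congr1 (fun k => Re (k t))); rewrite !ReImE /=; lra.
have df t : deriveC f t = 'i * (c t)%:C * f t.
  have := tangent t; have := unit_f t.
  rewrite /c; case: (deriveC f t) (f t) => [x' y'] [x y] /= e1 e2.
  apply: complexP; rewrite !ReImE /=.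
    transitivity (x' * (x ^+ 2 + y ^+ 2) - x * (x * x' + y * y')); last by ring.
    by rewrite e1 e2; ring.
  transitivity (y' * (x ^+ 2 + y ^+ 2) - y * (x * x' + y * y')); last by ring.
  by rewrite e1 e2; ring.
exists h => // t.
have sN := smooth_expi_comp (smooth_opp sh).
have := deriveC_eq0 (smoothC_mul sf sN).
rewrite (deriveC_mul sf sN) (deriveC_expi_comp (smooth_opp sh)).
rewrite (derive1_opp (smooth_derivable sh)).
have -> : (fun t0 => deriveC f t0 * expi (- h t0) +
   f t0 * ('i * (- (h^`())%classic t0)%:C * expi (- h t0))) = fun=> 0.
  by apply/funext => s; rewrite df dh rmorphN /=; ring.
move=> /(_ erefl t 0).
have -> : h 0 = a by rewrite /h addrC subrK.
rewrite -a0 -expiD addrN expi0.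
by move/(congr1 ( *%R^~ (expi (h t)))); rewrite -mulrA -expiD addNr expi0 mulr1 mul1r.
Qed.

(** The derivative of a lift is read off from the derivative of the lifted
    function, which removes the ambiguity of the angle. *)
Lemma lift_derive_unique h k : smooth_real h -> smooth_real k ->
  (forall t, expi (h t) = expi (k t)) -> (h^`())%classic = (k^`())%classic.
Proof.
move=> sh sk hk; apply/funext => t.
have := deriveC_expi_comp sh; have := deriveC_expi_comp sk.
rewrite (_ : (fun t => expi (h t)) = (fun t => expi (k t))); last exact/funext.
move=> -> /(congr1 (fun f => f t)); rewrite hk => /(mulIf (expi_neq0 _)).
by move=> /(congr1 Im); rewrite !ReImE /= !mul0r !mul1r !add0r.
Qed.

Lemma orientation_lift (psi : circle R -> circle R) h : smooth_real h ->
  (forall t, psi (cis t) = cis (h t)) -> orientation_preserving psi ->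
  forall t, 0 < (h^`())%classic t.
Proof.
move=> sh ph op t; have := op t.
under [X in deriveC X]eq_fun do rewrite ph val_cis.
rewrite -[X in _ < Im (X * _)]/((val (psi (cis t)))^*).
rewrite ph val_cis (deriveC_expi_comp sh) mulrCA mulcJ normc_expi expr1n mulr1.
by rewrite ReImE /= !mul0r mul1r add0r.
Qed.

Lemma smooth_map_lift (psi : circle R -> circle R) : smooth_map psi ->
  exists2 h, smooth_real h & forall t, psi (cis t) = cis (h t).
Proof.
move=> sp; have [h sh hE] := lift_exists sp (fun t => normc_circle (psi (cis t))).
by exists h => // t; apply: val_inj; exact: hE.
Qed.

Lemma smooth_fun_comp_lift (u : circle R -> R[i]) (psi : circle R -> circle R) :
  smooth_fun u -> smooth_map psi -> smooth_fun (u \o psi).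
Proof.
move=> su /smooth_map_lift[h sh hE].
have := smoothC_comp su sh; rewrite /smooth_fun.
by congr smooth; apply/funext => t /=; rewrite hE.
Qed.

(** The increment of h over a period is constant, positive, and maps to 1 under
    the exponential; by the intermediate value theorem some point would have
    two preimages under psi if it were larger than 2 pi. *)
Lemma lift_degree (psi : circle R -> circle R) h : smooth_real h -> injective psi ->
  (forall t, psi (cis t) = cis (h t)) -> (forall t, 0 < (h^`())%classic t) ->
  forall t, h (t + 2 * pi) = h t + 2 * pi.
Proof.
move=> sh ipsi ph h0; have inc := smooth_increasing sh h0.
have sk := smooth_comp sh (smooth_shift (2 * pi)).
have hk t : expi (h (t + 2 * pi)) = expi (h t).
  by rewrite -!val_cis -!ph cis_periodic.
have dk := lift_derive_unique sk sh hk.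
have cst s t : h (s + 2 * pi) - h s = h (t + 2 * pi) - h t.
  apply: (@smooth_eq_cst _ (fun t => h (t + 2 * pi) - h t)) => r.
  have := is_deriveB (smooth_is_derive sk r) (smooth_is_derive sh r).
  by rewrite dk subrr.
have h2 : h 0 < h (2 * pi) by apply: inc; exact: twopi_gt0.
suff E : h (2 * pi) - h 0 = 2 * pi.
  by move=> t; have := cst t 0; rewrite add0r E; lra.
have [lt|gt|//] := ltgtP (h (2 * pi) - h 0) (2 * pi).
  have := @expi_eq1 (h (2 * pi) - h 0); rewrite subr_gt0 h2 lt => /(_ isT).
  by rewrite expiD expiV -(hk 0) add0r mulfV ?expi_neq0 // eqxx.
have [|c] := @IVT R h 0 (2 * pi) (h 0 + 2 * pi) (ltW twopi_gt0)
    (@smooth_within _ _ _ sh).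
  have := @twopi_gt0 R => tp.
  by rewrite min_l ?max_r ?(ltW h2) //; apply/andP; split; lra.
rewrite in_itv /= => /andP[c0 c2] hc.
have lc : 0 < c.
  rewrite lt_neqAle c0 andbT; apply/eqP => e; move: hc; rewrite -e.
  by move/eqP; rewrite -subr_eq0 opprD addNKr oppr_eq0 (negbTE twopi_neq0).
have rc : c < 2 * pi.
  rewrite lt_neqAle c2 andbT; apply/eqP => e; move: gt; rewrite -e hc e; lra.
have := expi_eq1 (introT andP (conj lc rc)).
have /(congr1 val) : cis c = cis 0.
  by apply: ipsi; rewrite !ph hc cis_periodic.
by rewrite !val_cis expi0 => ->; rewrite eqxx.
Qed.

(** * Periodic functions and change of variables *)

Definition per f := forall t, f (t + 2 * pi) = f t.

Lemma per_cis (u : circle R -> R[i]) : per (u \o cis).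
Proof. by move=> t; rewrite /= cis_periodic. Qed.

Lemma deriveC_per f : smooth f -> per f -> per (deriveC f).
Proof.
move=> sf pf t.
have s2 := smooth_shift (2 * pi : R).
have := deriveC_comp sf s2; rewrite (_ : (fun t => f (t + _)) = f); last exact/funext.
by move=> /(congr1 (fun k => k t)) ->; rewrite derive1_shift mul1r.
Qed.

Lemma avg_deriveC_per f : smooth f -> per f -> avg (deriveC f) = 0.
Proof.
by move=> sf pf; rewrite (avg_deriveC sf) -[X in f X - _](add0r (2 * pi)) pf subrr mulr0.
Qed.

(** Over a period F o h increases by F (h 0 + 2 pi) - F (h 0); since F' is
    periodic this increment of F does not depend on the point h 0. *)
Lemma avg_change_var f h : smooth f -> per f -> smooth_real h ->
  (forall t, h (t + 2 * pi) = h t + 2 * pi) ->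
  avg (fun t => ((h^`())%classic t)%:C * f (h t)) = avg f.
Proof.
move=> + + sh h2; move=> /smoothC_primitive[F sF <-] pF.
rewrite -(deriveC_comp sF sh) (avg_deriveC sF) (avg_deriveC (smoothC_comp sF sh)).
congr (_ * _); rewrite -[in LHS](add0r (2 * pi)) h2.
have s2 := smooth_shift (2 * pi : R).
have sG := smoothC_comp sF s2.
have E : deriveC (fun t => F (t + 2 * pi) - F t) = fun=> 0.
  apply/funext => t; rewrite (deriveC_sub sG sF) (deriveC_comp sF s2) pF.
  by rewrite derive1_shift mul1r subrr.
by rewrite (deriveC_eq0 (smoothC_sub sG sF) E (h 0) 0) add0r.
Qed.

End Lifts.
Arguments expi {R} t : simpl never.

Section Action.
Context {R : realType}.
Implicit Types (f g : R -> R[i]) (h : R -> R) (z w : R[i]) (s t : R).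
Implicit Types (u v : circle R -> R[i]) (psi : circle_bij R).
Local Notation Re := (@complex.Re R).
Local Notation Im := (@complex.Im R).
Local Notation normc := (@Normc.normc R).

(** * Characters and Fourier coefficients *)

Definition expz (n : int) : circle R -> R[i] := fun c => val c ^ n.

Lemma expz_cis n t : expz n (cis t) = expi (n%:~R * t).
Proof. exact: expi_exprz. Qed.

Lemma expz_cisE n : expz n \o cis = (fun t => expi (n%:~R * t)).
Proof. by apply/funext => t; exact: expz_cis. Qed.

Lemma smooth_expz n : smooth_fun (expz n).
Proof. rewrite /smooth_fun expz_cisE; exact: smooth_expi_linear. Qed.

Lemma avg_expi (k : int) : avg (fun t => expi (k%:~R * t)) = (k == 0)%:R :> R[i].
Proof.
have [->|k0] := eqVneq k 0.
  under eq_fun do rewrite mul0r expi0.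
  exact: avg_cst.
have kR : (k%:~R : R)%:C != 0 :> R[i].
  by apply/eqP => /(congr1 Re) /= /eqP; rewrite intr_eq0 (negbTE k0).
have i0 : 'i != 0 :> R[i] by apply/eqP => /(congr1 Im) /= /eqP; rewrite oner_eq0.
have ski := @smooth_expi_linear R k%:~R.
have := avg_deriveC_per ski; rewrite deriveC_expi_linear (avgZ _ ski).
have pk : per (fun t => expi (k%:~R * t) : R[i]).
  by move=> t; rewrite -!expi_exprz expi_periodic.
by move/(_ pk)/eqP; rewrite !mulf_eq0 (negbTE kR) (negbTE i0) => /eqP.
Qed.

Lemma fourierE u n : fourier u n = avg (fun t => u (cis t) * expi ((- n)%:~R * t)).
Proof. by congr avg; apply/funext => t; rewrite -expi_exprz. Qed.

Lemma smooth_fourier u n : smooth_fun u ->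
  smooth (fun t => u (cis t) * expi ((- n)%:~R * t)).
Proof. by move=> su; exact (smoothC_mul su (smooth_expi_linear _)). Qed.

Lemma fourier_expz (m n : int) : fourier (expz m) n = (m == n)%:R.
Proof.
rewrite fourierE -subr_eq0 -avg_expi; congr avg; apply/funext => t.
by rewrite expz_cis -expiD -mulrDl -intrD.
Qed.

Lemma fourierD u v n : smooth_fun u -> smooth_fun v ->
  fourier (fun c => u c + v c) n = fourier u n + fourier v n.
Proof.
move=> su sv; rewrite !fourierE -(avgD (smooth_fourier n su) (smooth_fourier n sv)).
by congr avg; apply/funext => t; rewrite mulrDl.
Qed.

Lemma fourierZ z u n : smooth_fun u ->
  fourier (fun c => z * u c) n = z * fourier u n.
Proof.
move=> su; rewrite !fourierE -(avgZ _ (smooth_fourier n su)).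
by congr avg; apply/funext => t; rewrite mulrA.
Qed.

Lemma fourier_sum (I : Type) (r : seq I) (P : pred I) (F : I -> circle R -> R[i]) n :
  (forall i, P i -> smooth_fun (F i)) ->
  fourier (fun c => \sum_(i <- r | P i) F i c) n = \sum_(i <- r | P i) fourier (F i) n.
Proof.
move=> sF; under eq_bigr do rewrite fourierE.
rewrite -avg_sum; last by move=> i Pi; exact (smooth_fourier n (sF i Pi)).
by rewrite fourierE; congr avg; apply/funext => t; rewrite mulr_suml.
Qed.

Lemma fourier_conj u n : smooth_fun u -> fourier (conj_fun u) n = (fourier u (- n))^*.
Proof.
move=> su; rewrite !fourierE -(avg_conj (smooth_fourier (- n) su)).
congr avg; apply/funext => t; rewrite conjcM -expiN; congr (_ * expi _).
by rewrite opprK mulrNz mulNr.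
Qed.

Lemma fourier_deriveC f g n : smooth f -> per f ->
  avg (fun t => deriveC f t * expi ((- n)%:~R * t)) =
  'i * (n%:~R)%:C * avg (fun t => f t * expi ((- n)%:~R * t)).
Proof.
move=> sf pf; have se := @smooth_expi_linear R (- n)%:~R.
have sM := smoothC_mul sf se.
have pM : per (fun t => f t * expi ((- n)%:~R * t)).
  by move=> t; rewrite pf -!expi_exprz expi_periodic.
have := avg_deriveC_per sM pM; rewrite (deriveC_mul sf se) deriveC_expi_linear.
under eq_fun do rewrite mulrCA.
rewrite (avgD (smoothC_mul (smoothC_deriveC sf) se) (smoothC_mul (smoothC_cst _) sM)).
rewrite (avgZ _ sM) => /eqP; rewrite addr_eq0 => /eqP ->.
by rewrite mulrNz rmorphN mulrN mulNr opprK.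
Qed.

Lemma Hspace_expz n : n != 0 -> Hspace (expz n).
Proof.
by move=> n0; split; [exact: smooth_expz|rewrite expz_cisE avg_expi (negbTE n0)].
Qed.

Lemma HspaceZD z u v : Hspace u -> Hspace v -> Hspace (fun c => z * u c + v c).
Proof.
move=> [su u0] [sv v0]; split.
  exact (smoothC_add (smoothC_mul (smoothC_cst z) su) sv).
rewrite (avgD (smoothC_mul (smoothC_cst z) su) sv) (avgZ _ su).
by rewrite [avg _]u0 [avg _]v0 mulr0 addr0.
Qed.

Lemma Hspace0 : Hspace (fun=> 0 : R[i]).
Proof. by split; [exact: smoothC_cst|exact: avg_cst]. Qed.

Lemma HspaceD u v : Hspace u -> Hspace v -> Hspace (fun c => u c + v c).
Proof.
move=> Hu Hv; have := HspaceZD 1 Hu Hv.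
by congr Hspace; apply/funext => c; rewrite mul1r.
Qed.

Lemma HspaceZ z u : Hspace u -> Hspace (fun c => z * u c).
Proof.
move=> Hu; have := HspaceZD z Hu Hspace0.
by congr Hspace; apply/funext => c; rewrite addr0.
Qed.

Lemma Hspace_sum (I : Type) (r : seq I) (P : pred I) (F : I -> circle R -> R[i]) :
  (forall i, P i -> Hspace (F i)) -> Hspace (fun c => \sum_(i <- r | P i) F i c).
Proof.
move=> HF; rewrite (_ : (fun c => _) = \sum_(i <- r | P i) F i); last first.
  by apply/funext => c; rewrite fct_sumE.
elim/big_rec: _ => [|i f Pi Hf]; first exact: Hspace0.
exact (HspaceD (HF i Pi) Hf).
Qed.

Lemma Hspace_conj u : Hspace u -> Hspace (conj_fun u).
Proof.
move=> [su u0]; split; first exact (smoothC_conj su).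
by rewrite (avg_conj su) [avg _]u0 conjc0.
Qed.

(** * The action of diffeomorphisms on Hspace *)

Lemma Phi_lift psi h u t : (forall t, cb_inv psi (cis t) = cis (h t)) ->
  Phi psi u (cis t) = u (cis (h t)) - avg (fun t => u (cis (h t))).
Proof. by move=> hE; rewrite /Phi hE; under eq_fun do rewrite hE. Qed.

Lemma smooth_pullback psi u : smooth_map (cb_inv psi) -> smooth_fun u ->
  smooth (fun t => u (cb_inv psi (cis t))).
Proof. by move=> sp su; exact (smooth_fun_comp_lift su sp). Qed.

Lemma Phi_Hspace psi u : smooth_map (cb_inv psi) -> smooth_fun u -> Hspace (Phi psi u).
Proof.
move=> sp su; have s := smooth_pullback sp su.
split; first exact (smoothC_sub s (smoothC_cst _)).
by rewrite (avgB s (smoothC_cst _)) avg_cst subrr.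
Qed.

Lemma Phi_linear psi : smooth_map (cb_inv psi) -> linear_on_H (Phi psi).
Proof.
move=> sp z u v [su _] [sv _]; have s1 := smooth_pullback sp su.
have s2 := smooth_pullback sp sv.
apply/funext => c; rewrite /Phi (avgD (smoothC_mul (smoothC_cst z) s1) s2).
by rewrite (avgZ _ s1); ring.
Qed.

Lemma Phi_conj psi : smooth_map (cb_inv psi) -> eq_on_H (Phi psi) (conj_op (Phi psi)).
Proof.
move=> sp u [su _]; apply/funext => c; have s := smooth_pullback sp su.
by rewrite /conj_op /conj_fun /Phi (avg_conj s) conjcB !conjcK.
Qed.

Lemma Phi_comp psi1 psi2 : smooth_map (cb_inv psi1) -> smooth_map (cb_inv psi2) ->
  eq_on_H (Phi (circle_bij_comp psi1 psi2)) (fun u => Phi psi1 (Phi psi2 u)).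
Proof.
move=> sp1 sp2 u [su _]; apply/funext => c; rewrite /Phi /=.
have s := smooth_pullback sp1 (smooth_fun_comp_lift su sp2 : smooth_fun _).
by rewrite [in RHS](avgB s (smoothC_cst _)) avg_cst; ring.
Qed.

Definition circle_bij_inv psi := CircleBij (cb_invK psi) (cb_funK psi).

Lemma Phi_id psi u : cb_inv psi =1 id -> Hspace u -> Phi psi u = u.
Proof.
move=> pid [su u0]; apply/funext => c; rewrite /Phi pid.
by under eq_fun do rewrite pid; rewrite [avg _]u0 subr0.
Qed.

Lemma Phi_bij psi : smooth_map psi -> smooth_map (cb_inv psi) ->
  set_bij Hspace Hspace (Phi psi).
Proof.
move=> sp si; set inv := circle_bij_inv psi.
have K1 u : Hspace u -> Phi inv (Phi psi u) = u.
  move=> Hu; rewrite -(@Phi_comp inv psi sp si u Hu) Phi_id //.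
  exact: cb_funK.
have K2 u : Hspace u -> Phi psi (Phi inv u) = u.
  move=> Hu; rewrite -(@Phi_comp psi inv si sp u Hu) Phi_id //.
  exact: cb_invK.
split.
- by move=> u [su _]; exact: Phi_Hspace.
- by move=> u v /set_mem Hu /set_mem Hv /(congr1 (Phi inv)); rewrite !K1.
- move=> u Hu; exists (Phi inv u); last exact: K2.
  by case: Hu => su _; exact: Phi_Hspace.
Qed.

(** The action involves psi^-1, whereas the orientation hypothesis is on psi: the
    composition of the lifts of psi and psi^-1 lifts the identity, hence has
    derivative 1, and the sign follows from the chain rule. *)
Lemma inverse_lift psi : Diff_circle psi -> exists h, [/\ smooth_real h,
  forall t, cb_inv psi (cis t) = cis (h t), forall t, 0 < (h^`())%classic t
  & forall t, h (t + 2 * pi) = h t + 2 * pi].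
Proof.
move=> [sp si op].
have [k sk kE] := smooth_map_lift sp; have [h sh hE] := smooth_map_lift si.
have k0 := orientation_lift sk kE op.
have h0 t : 0 < (h^`())%classic t.
  have : ((fun t => k (h t))^`())%classic = ((fun t => t)^`())%classic.
    apply: (lift_derive_unique (smooth_comp sk sh) smooth_id) => s.
    by rewrite -!val_cis -kE -hE cb_invK.
  rewrite derive1_idE (derive1_compE (smooth_derivable sk) (smooth_derivable sh)).
  by move=> /(congr1 (fun q => q t)) e; rewrite -(pmulr_rgt0 _ (k0 (h t))) e.
exists h; split => //.
exact (lift_degree sh (can_inj (cb_invK psi)) hE h0).
Qed.

(** The constants subtracted by the action drop out because the derivative of a
    periodic function has average zero; what remains is the change of
    variables h, whose Jacobian comes from the derivative of the second
    argument. *)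
Lemma omega_Phi psi : Diff_circle psi -> forall u v, Hspace u -> Hspace v ->
  omega (Phi psi u) (Phi psi v) = omega u v.
Proof.
move=> /inverse_lift[h [sh hE h0 h2]] u v [su u0] [sv v0].
have sU := smoothC_comp su sh; have sV := smoothC_comp sv sh.
have sh' := smoothC_real (smooth_realD1 sh).
have sV' := smoothC_deriveC sv; have pV' := deriveC_per sv (per_cis v).
have sUV := smoothC_mul su sV'.
have dV : deriveC (Phi psi v \o cis) =
    (fun t => ((h^`())%classic t)%:C * deriveC (v \o cis) (h t)).
  rewrite -(deriveC_comp sv sh).
  have -> : Phi psi v \o cis =
      (fun t => (v \o cis) (h t) - avg (fun t => (v \o cis) (h t))).
    by apply/funext => t; exact: Phi_lift.
  rewrite (deriveC_sub sV (smoothC_cst _)) deriveC_cst.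
  by apply/funext => t; rewrite subr0.
rewrite /omega dV.
under eq_fun do rewrite (Phi_lift _ _ hE) mulrBl mulrCA.
have sa := smoothC_mul sh' (smoothC_comp sUV sh).
have sb := smoothC_mul sh' (smoothC_comp sV' sh).
rewrite (avgB sa (smoothC_mul (smoothC_cst _) sb)) (avgZ _ sb).
rewrite (avg_change_var sV' pV' sh h2) (avg_deriveC_per sv (per_cis v)) mulr0 subr0.
apply: (avg_change_var sUV _ sh h2) => t.
by rewrite /= cis_periodic pV'.
Qed.

End Action.

(** * The Fejer kernel *)

Section Fejer.
Context {R : realType}.
Implicit Types (f g : R -> R[i]) (h : R -> R) (z w : R[i]) (s t : R).
Local Notation Re := (@complex.Re R).
Local Notation Im := (@complex.Im R).
Local Notation normc := (@Normc.normc R).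

Lemma normc_le_ReIm z : normc z <= `|Re z| + `|Im z|.
Proof.
rewrite -(ler_pXn2r (ltn0Sn 1)) ?nnegrE ?normc_ge0 ?addr_ge0 // normc_sqr.
rewrite sqrrD !real_normK ?num_real // [leRHS]addrAC lerDl.
by rewrite mulrn_wge0 // mulr_ge0.
Qed.

(** As sin t = 2 sin (t/2) cos (t/2) and, by the mean value theorem,
    sin (t/2) >= (t/2) cos (t/2), one has sin t >= t cos (t/2)^2, and
    cos (t/2)^2 >= 1/2 because cos t >= 0. *)
Lemma sin_ge_half t : 0 <= t <= pi / 2 -> t / 2 <= sin t.
Proof.
move=> /andP[t0 tp]; have p0 := @pi_gt0 R.
have [x] := @MVT_segment R sin cos 0 (t / 2) (divr_ge0 t0 (ler0n _ 2))
  (fun x _ => is_derive_sin x) (@smooth_within _ _ _ smooth_sin).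
rewrite in_itv /= sin0 !subr0 => /andP[x0 xt] sx.
have cx : cos (t / 2) <= cos x.
  have [<-//|xt'] := eqVneq x (t / 2).
  by apply/ltW; rewrite ltr_cos ?in_itv /=; try (apply/andP; split); lra.
have c0 : 0 <= cos (t / 2) by apply: cos_ge0_pihalf; apply/andP; split; lra.
have ct : 0 <= cos t by apply: cos_ge0_pihalf; apply/andP; split; lra.
have t2 : t = t / 2 *+ 2 by rewrite -mulr_natl; field.
have -> : sin t = cos x * t * cos (t / 2).
  by rewrite {1}t2 sin_mulr2n sx -mulr_natl; field.
move: ct; rewrite {1}t2 cos_mulr2n subr_ge0 -mulr_natl => c2.
apply: (@le_trans _ _ (cos (t / 2) ^+ 2 * t)).
  by rewrite [leLHS]mulrC ler_wpM2r //; lra.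
by rewrite expr2 mulrAC ler_wpM2r // ler_wpM2r.
Qed.

Lemma normc_expi_sub1_sqr t : normc (expi t - 1) ^+ 2 = 2 - 2 * cos t.
Proof.
rewrite normc_sqr !ReImE /= oppr0 addr0.
have := cos2Dsin2 t; rewrite /expi /=; lra.
Qed.

Lemma arc_le_chord t : - pi <= t <= pi -> `|t| <= 2 * normc (expi t - 1).
Proof.
suff H (x : R) : 0 <= x <= pi -> x <= 2 * normc (expi x - 1).
  move=> /andP[a b]; have [t0|t0] := leP 0 t; first by rewrite ger0_norm // H // t0.
  have -> : normc (expi t - 1) = normc (expi (- t) - 1).
    by apply: (pexpIrn (ltn0Sn 1)); rewrite ?nnegrE ?normc_ge0 // !normc_expi_sub1_sqr cosN.
  by rewrite ltr0_norm // H // oppr_ge0 ltW //= lerNl.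
move=> /andP[x0 xp].
rewrite -(ler_pXn2r (ltn0Sn 1)) ?nnegrE ?mulr_ge0 ?normc_ge0 // exprMn.
rewrite normc_expi_sub1_sqr.
have /sin_ge_half sx : 0 <= x / 2 <= pi / 2 by apply/andP; split; lra.
have {sx} : (x / 2 / 2) ^+ 2 <= sin (x / 2) ^+ 2.
  by apply: lerXn2r => //; rewrite nnegrE; lra.
rewrite (_ : cos x = cos (x / 2 *+ 2)); last by congr cos; rewrite -mulr_natl; field.
rewrite cos_mulr2n; have := cos2Dsin2 (x / 2).
rewrite (_ : (x / 2 / 2) ^+ 2 = x ^+ 2 / 16); last by field.
lra.
Qed.

(** Two points of [0, 2 pi] are at angular distance at most pi after moving
    one of them by a period. *)
Lemma smooth_chord_lipschitz f : smooth f -> per f -> exists2 L : R, 0 < L &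
  forall s t, 0 <= s <= 2 * pi -> 0 <= t <= 2 * pi ->
    normc (f t - f s) <= L * normc (expi t - expi s).
Proof.
move=> sf pf; have p0 := @pi_gt0 R; have [fr fi] := sf.
have ab : - (2 * pi) <= 4 * pi :> R by lra.
have [M M0 MM] := smooth_bounded ab (smooth_realD1 fr).
have [M' M0' MM'] := smooth_bounded ab (smooth_realD1 fi).
have rot s t : normc (expi t - expi s) = normc (expi (t - s) - 1).
  have -> : expi t - expi s = expi s * (expi (t - s) - 1).
    by rewrite mulrBr -expiD mulr1 [s + _]addrC subrK.
  by rewrite Normc.normcM normc_expi mul1r.
have lip s t : 0 <= s <= 2 * pi -> - (2 * pi) <= t <= 4 * pi -> - pi <= t - s <= pi ->
    normc (f t - f s) <= 2 * (M + M') * normc (expi t - expi s).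
  move=> /andP[s0 s2] tb ts.
  have sb : - (2 * pi) <= s <= 4 * pi by apply/andP; split; lra.
  apply: (le_trans (normc_le_ReIm _)); rewrite !ReImE.
  have l1 := smooth_lipschitz fr MM sb tb; have l2 := smooth_lipschitz fi MM' sb tb.
  apply: (le_trans (lerD l1 l2)); rewrite -mulrDl rot [2 * _]mulrC -mulrA.
  by rewrite ler_wpM2l ?arc_le_chord // ltW // addr_gt0.
exists (2 * (M + M')); first by rewrite mulr_gt0 // addr_gt0.
move=> s t s2 t2; have [/andP[s0 s1] /andP[t0 t1]] := (s2, t2).
have [le1|gt1] := leP (t - s) pi; last first.
  rewrite -[t](subrK (2 * pi)) pf expi_periodic.
  by apply: lip => //; apply/andP; split; lra.
have [ge1|lt1] := leP (- pi) (t - s).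
  by apply: lip => //; apply/andP; split; lra.
rewrite -pf -expi_periodic.
by apply: lip => //; apply/andP; split; lra.
Qed.

Definition fcoef f (n : int) : R[i] := avg (fun t => f t * expi ((- n)%:~R * t)).

Lemma fourier_fcoef (u : circle R -> R[i]) n : fourier u n = fcoef (u \o cis) n.
Proof. exact: fourierE. Qed.

(** Usually written N^-1 (sin (N x / 2) / sin (x / 2))^2. *)
Definition fejer_kernel (N : nat) (x : R) : R :=
  normc (\sum_(k < N) expi (k%:R * x)) ^+ 2 / N%:R.

Definition fejer_weight (N n : nat) : R := (N - n.+1)%:R / N%:R.

(** The sum over |n| < N of (1 - |n| / N) c_n e^(i n s), with opposite
    frequencies grouped. *)
Definition fejer_sum (N : nat) f s : R[i] :=
  fcoef f 0 + \sum_(n < N) (fejer_weight N n)%:C *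
    (fcoef f n.+1 * expi (n.+1%:R * s) + fcoef f (- n.+1%:Z) * expi (- n.+1%:R * s)).

(** There are N - |d| pairs (k, l) on the diagonal l - k = d. *)
Lemma sum_diff_diagonals (V : zmodType) (F : int -> V) (N : nat) :
  \sum_(k < N) \sum_(l < N) F (l%:Z - k%:Z) =
  F 0 *+ N + \sum_(n < N) (F n.+1%:Z + F (- n.+1%:Z)) *+ (N - n.+1).
Proof.
elim: N => [|N IHN]; first by rewrite !big_ord0 mulr0n addr0.
rewrite big_ord_recr /=; under eq_bigr do rewrite big_ord_recr /=.
rewrite big_split /= IHN big_ord_recr /= subrr.
rewrite [in RHS]big_ord_recr /= subnn mulr0n addr0.
have -> : \sum_(n < N) (F n.+1%:Z + F (- n.+1%:Z)) *+ (N.+1 - n.+1) =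
  \sum_(n < N) (F n.+1%:Z + F (- n.+1%:Z)) *+ (N - n.+1) +
  \sum_(n < N) (F n.+1%:Z + F (- n.+1%:Z)).
  rewrite -big_split /=; apply: eq_bigr => n _.
  by rewrite subSS -mulrSr -subSn.
rewrite [X in _ = _ + (_ + X)]big_split /= mulrSr.
have -> : \sum_(j < N) F (N%:Z - j%:Z) = \sum_(n < N) F n.+1%:Z.
  rewrite (reindex_inj rev_ord_inj) /=.
  by apply: eq_bigr => j _; congr F; have := ltn_ord j; lia.
have -> : \sum_(j < N) F (j%:Z - N%:Z) = \sum_(n < N) F (- n.+1%:Z).
  rewrite (reindex_inj rev_ord_inj) /=.
  by apply: eq_bigr => j _; congr F; have := ltn_ord j; lia.
set a := _ *+ N; set b := \sum_(n < N) _ *+ _; set c := \sum_(n < N) F _.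
set d := \sum_(n < N) F _.
by rewrite -!addrA; congr (_ + _); rewrite [RHS]addrC -!addrA.
Qed.

Lemma smooth_expi_shift (a s : R) : smooth (fun t => expi (a * (t - s))).
Proof.
exact (smooth_expi_comp (smooth_mul (smooth_cst a) (smooth_shift (- s)))).
Qed.

Lemma smooth_fejer_kernel N s : smooth_real (fun t => fejer_kernel N (t - s)).
Proof.
rewrite /fejer_kernel; under eq_fun do rewrite normc_sqr !expr2.
have [sr si] : smooth (fun t => \sum_(k < N) expi (k%:R * (t - s))).
  exact (smoothC_sum _ (fun (k : 'I_N) _ => smooth_expi_shift k%:R s)).
exact (smooth_mul (smooth_add (smooth_mul sr sr) (smooth_mul si si)) (smooth_cst _)).
Qed.

Lemma fejer_kernelE N x : (0 < N)%N -> (fejer_kernel N x)%:C = 1 +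
  \sum_(n < N) (fejer_weight N n)%:C * (expi (- n.+1%:R * x) + expi (n.+1%:R * x)).
Proof.
move=> N0; have NR : N%:R != 0 :> R by rewrite pnatr_eq0 -lt0n.
rewrite /fejer_kernel rmorphM /= -mulcJ (_ : (\sum__ _)^* = \sum_(k < N) expi (- k%:R * x)); last first.
  by rewrite conjc_sum; apply: eq_bigr => k _; rewrite mulNr expiN.
rewrite mulr_suml.
under [X in X * _]eq_bigr => k _ do rewrite mulr_sumr.
have E (k l : 'I_N) : expi (- k%:R * x) * expi (l%:R * x) =
    (fun d : int => expi (d%:~R * x)) (l%:Z - k%:Z).
  by rewrite /= -expiD; congr expi; rewrite intrD mulrNz /= mulrDl addrC.
under [X in X * _]eq_bigr => k _ do under eq_bigr => l _ do rewrite E.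
rewrite (sum_diff_diagonals (fun d : int => expi (d%:~R * x))) mul0r expi0.
rewrite mulrDl mulr_suml; congr (_ + _).
  by rewrite -natC -rmorphM /= mulfV.
apply: eq_bigr => n _; rewrite /fejer_weight rmorphM /= -[(_ + _) *+ _]mulr_natr natC.
rewrite -mulrA mulrC; congr (_ * _); exact: addrC.
Qed.
End Fejer.
Arguments smooth_fejer_kernel {R} N s.

(** * Fejer means and one half of Parseval's identity *)

Section FejerConvergence.
Context {R : realType}.
Implicit Types (f g : R -> R[i]) (h : R -> R) (z w : R[i]) (s t : R).
Local Notation Re := (@complex.Re R).
Local Notation Im := (@complex.Im R).
Local Notation normc := (@Normc.normc R).

Lemma fcoef0 f : fcoef f 0 = avg f.
Proof. by congr avg; apply/funext => t; rewrite oppr0 mul0r expi0 mulr1. Qed.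

Lemma smooth_fcoef f (a : R) : smooth f -> smooth (fun t => f t * expi (a * t)).
Proof. by move=> sf; exact (smoothC_mul sf (smooth_expi_linear a)). Qed.

Lemma avg_fejer_kernel N f s : smooth f -> (0 < N)%N ->
  avg (fun t => f t * (fejer_kernel N (t - s))%:C) = fejer_sum N f s.
Proof.
move=> sf N0.
pose A (n : nat) t := f t * expi (- n.+1%:R * t) * expi (n.+1%:R * s).
pose B (n : nat) t := f t * expi (n.+1%:R * t) * expi (- n.+1%:R * s).
pose G (n : nat) t := (fejer_weight N n)%:C * (A n t + B n t).
have sA n : smooth (A n) := smoothC_mul (smooth_fcoef _ sf) (smoothC_cst _).
have sB n : smooth (B n) := smoothC_mul (smooth_fcoef _ sf) (smoothC_cst _).
have sG n : smooth (G n) := smoothC_mul (smoothC_cst _) (smoothC_add (sA n) (sB n)).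
have -> : (fun t => f t * (fejer_kernel N (t - s))%:C) =
    (fun t => f t + \sum_(n < N) G n t).
  apply/funext => t; rewrite (fejer_kernelE _ N0) mulrDr mulr1; congr (_ + _).
  rewrite mulr_sumr; apply: eq_bigr => n _; rewrite mulrCA /G /A /B mulrDr.
  by rewrite -!mulrA -!expiD; congr (_ * (_ * expi _ + _ * expi _)); ring.
have sS : smooth (fun t => \sum_(n < N) G n t).
  exact (smoothC_sum _ (fun (n : 'I_N) _ => sG n)).
rewrite (avgD sf sS) -fcoef0 (avg_sum _ (fun (n : 'I_N) _ => sG n)).
congr (_ + _); apply: eq_bigr => n _.
rewrite (avgZ _ (smoothC_add (sA n) (sB n))) (avgD (sA n) (sB n)).
by rewrite (avgZr _ (smooth_fcoef _ sf)) (avgZr _ (smooth_fcoef _ sf)).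
Qed.

Lemma avg_fejer_kernel1 N s : (0 < N)%N ->
  avg (fun t => (fejer_kernel N (t - s))%:C : R[i]) = 1.
Proof.
move=> N0; have := avg_fejer_kernel s (smoothC_cst 1) N0.
under eq_fun do rewrite mul1r.
rewrite /fejer_sum fcoef0 avg_cst => ->; rewrite big1 ?addr0 // => n _.
have fc0 (k : int) : k != 0 -> fcoef (fun=> 1 : R[i]) k = 0.
  move=> k0; rewrite /fcoef; under eq_fun do rewrite mul1r.
  by rewrite avg_expi oppr_eq0 (negbTE k0).
by rewrite !fc0 // !mul0r addr0 mulr0.
Qed.

Lemma chord_fejer_kernel N x :
  normc (expi x - 1) ^+ 2 * fejer_kernel N x <= 4 / N%:R.
Proof.
rewrite /fejer_kernel mulrA -exprMn -Normc.normcM.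
under eq_bigr do rewrite -expiX.
rewrite -subrX1 ler_wpM2r // expiX.
have : normc (expi (N%:R * x) - 1) <= 2.
  apply: (le_trans (normc_add _ _)).
  by rewrite normcN normc_expi Normc.normc1; lra.
move=> n2; have -> : 4 = 2 ^+ 2 :> R by ring.
by apply: lerXn2r => //; rewrite nnegrE ?normc_ge0.
Qed.

(** As |f t - f s| <= L |e^(it) - e^(is)|, the second moment of f - f s for
    the Fejer kernel is O(1 / N); the first moment is bounded through
    x <= e / 2 + x^2 / (2 e), the average of the kernel being one. *)
Lemma fejer_cvg f : smooth f -> per f -> forall e : R, 0 < e ->
  exists N0 : nat, forall N, (N0 < N)%N ->
    forall s, 0 <= s <= 2 * pi -> normc (fejer_sum N f s - f s) <= e.
Proof.
move=> sf pf e e0; have [L L0 Lip] := smooth_chord_lipschitz sf pf.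
(* The bound is e / 2 + 2 L^2 / (e N). *)
exists (Num.truncn (4 * L ^+ 2 / e ^+ 2)) => N N0 s s2.
have NL : 4 * L ^+ 2 / e ^+ 2 < N%:R.
  by apply: (lt_le_trans (truncnS_gt _)); rewrite ler_nat.
have Ngt0 : (0 < N)%N by apply: leq_trans N0.
have NR : 0 < N%:R :> R by rewrite ltr0n.
have sK := smoothC_real (smooth_fejer_kernel N s).
rewrite -(avg_fejer_kernel s sf Ngt0) -[X in _ - X]mulr1.
rewrite -[X in _ - _ * X](avg_fejer_kernel1 s Ngt0) -(avgZ _ sK).
rewrite -(avgB (smoothC_mul sf sK) (smoothC_mul (smoothC_cst (f s)) sK)).
pose c := L ^+ 2 / (2 * e) * (4 / N%:R).
pose h t := e / 2 * fejer_kernel N (t - s) + c.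
have sh : smooth_real h.
  exact (smooth_add (smooth_mul (smooth_cst _) (smooth_fejer_kernel N s)) (smooth_cst c)).
apply: (@le_trans _ _ (Re (avg (fun t => (h t)%:C)))).
  apply: (normc_avg_le _ sh).
    exact (smoothC_sub (smoothC_mul sf sK) (smoothC_mul (smoothC_cst (f s)) sK)).
  move=> t t2; rewrite -mulrBl Normc.normcM normc_real.
  have K0 : 0 <= fejer_kernel N (t - s) by rewrite mulr_ge0 ?sqr_ge0 // invr_ge0.
  rewrite ger0_norm // /h /c; set x := normc _.
  have x0 : 0 <= x := normc_ge0 _.
  set y := normc (expi (t - s) - 1).
  have xy : x <= L * y.
    have := Lip s t s2 t2; rewrite -/x /y; congr (_ <= _ * _).
    have -> : expi t - expi s = expi s * (expi (t - s) - 1).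
      by rewrite mulrBr -expiD mulr1 [s + _]addrC subrK.
    by rewrite Normc.normcM normc_expi mul1r.
  have x2 : x ^+ 2 <= L ^+ 2 * y ^+ 2.
    rewrite -exprMn; apply: lerXn2r => //; rewrite nnegrE //.
    exact: le_trans xy.
  have xe : x <= e / 2 + x ^+ 2 / (2 * e).
    rewrite -subr_ge0 (_ : _ - x = (x - e) ^+ 2 / (2 * e)).
      by rewrite divr_ge0 ?sqr_ge0 // mulr_ge0 // ltW.
    by field; rewrite gt_eqF.
  apply: (le_trans (ler_wpM2r K0 xe)); rewrite mulrDl lerD2l.
  apply: (@le_trans _ _ (L ^+ 2 / (2 * e) * (y ^+ 2 * fejer_kernel N (t - s)))).
    have -> : L ^+ 2 / (2 * e) * (y ^+ 2 * fejer_kernel N (t - s)) =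
        L ^+ 2 * y ^+ 2 / (2 * e) * fejer_kernel N (t - s) by ring.
    rewrite (ler_wpM2r K0) // ler_wpM2r //.
    by rewrite invr_ge0 mulr_ge0 // ltW.
  apply: ler_wpM2l; last exact: chord_fejer_kernel.
  by rewrite divr_ge0 ?sqr_ge0 // mulr_ge0 // ltW.
under eq_fun do rewrite /h rmorphD rmorphM /=.
rewrite (avgD (smoothC_mul (smoothC_cst _) sK) (smoothC_cst _)) avg_cst (avgZ _ sK).
rewrite (avg_fejer_kernel1 s Ngt0) mulr1 /= /c.
suff : L ^+ 2 / (2 * e) * (4 / N%:R) <= e / 2 by lra.
rewrite mulrA ler_pdivrMr //.
rewrite (_ : _ * 4 = e / 2 * (4 * L ^+ 2 / e ^+ 2)); last by field; rewrite gt_eqF.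
by rewrite ler_wpM2l ?(ltW NL) // divr_ge0 // ltW.
Qed.

Lemma fcoef_deriveC f n : smooth f -> per f ->
  fcoef (deriveC f) n = 'i * (n%:~R)%:C * fcoef f n.
Proof. exact: fourier_deriveC. Qed.

Lemma avg_conj_expi f (a : R) : smooth f ->
  avg (fun t => (f t)^* * expi (a * t)) = (avg (fun t => f t * expi (- a * t)))^*.
Proof.
move=> sf; rewrite -(avg_conj (smooth_fcoef _ sf)); congr avg; apply/funext => t.
by rewrite conjcM -expiN mulNr opprK.
Qed.

Lemma smooth_fejer_sum N f : smooth (fejer_sum N f).
Proof.
have sE z (b : R) : smooth (fun t => z * expi (b * t)).
  exact (smoothC_mul (smoothC_cst z) (smooth_expi_linear b)).
exact (smoothC_add (smoothC_cst _) (smoothC_sum _ (fun (n : 'I_N) _ =>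
  smoothC_mul (smoothC_cst _) (smoothC_add (sE _ _) (sE _ _))))).
Qed.

(** Twice the signed area enclosed by f, divided by 2 pi. *)
Definition area f : R := Im (avg (fun t => (f t)^* * deriveC f t)).

Lemma area_fejer N f : smooth f -> per f ->
  Im (avg (fun t => (f t)^* * fejer_sum N (deriveC f) t)) =
  \sum_(n < N) fejer_weight N n *
    (n.+1%:R * (normc (fcoef f n.+1) ^+ 2 - normc (fcoef f (- n.+1%:Z)) ^+ 2)).
Proof.
move=> sf pf; have sc := smoothC_conj sf.
have f0 : fcoef (deriveC f) 0 = 0 by rewrite fcoef_deriveC // mulr0 mul0r.
pose A (n : nat) t := fcoef (deriveC f) n.+1 * ((f t)^* * expi (n.+1%:R * t)).
pose B (n : nat) t := fcoef (deriveC f) (- n.+1%:Z) * ((f t)^* * expi (- n.+1%:R * t)).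
have sA n : smooth (A n) := smoothC_mul (smoothC_cst _) (smooth_fcoef _ sc).
have sB n : smooth (B n) := smoothC_mul (smoothC_cst _) (smooth_fcoef _ sc).
pose G (n : nat) t := (fejer_weight N n)%:C * (A n t + B n t).
have sG n : smooth (G n) := smoothC_mul (smoothC_cst _) (smoothC_add (sA n) (sB n)).
have -> : (fun t => (f t)^* * fejer_sum N (deriveC f) t) =
    (fun t => \sum_(n < N) G n t).
  apply/funext => t; rewrite /fejer_sum f0 add0r mulr_sumr; apply: eq_bigr => n _.
  by rewrite /G /A /B; ring.
rewrite (avg_sum _ (fun (n : 'I_N) _ => sG n)).
rewrite (big_morph Im (@ImD R) (erefl : Im 0 = 0)); apply: eq_bigr => n _.
rewrite (avgZ _ (smoothC_add (sA n) (sB n))) (avgD (sA n) (sB n)).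
rewrite (avgZ _ (smooth_fcoef _ sc)) (avgZ _ (smooth_fcoef _ sc)).
rewrite !(avg_conj_expi _ sf) opprK !fcoef_deriveC //.
have -> : avg (fun t => f t * expi (- n.+1%:R * t)) = fcoef f n.+1 by [].
have -> : avg (fun t => f t * expi (n.+1%:R * t)) = fcoef f (- n.+1%:Z) by [].
rewrite !normc_sqr; set a := fcoef f _; set b := fcoef f _.
move: a b => [a1 a2] [b1 b2]; rewrite !ReImE mulrNz /=; ring.
Qed.

Lemma fejer_weight_ge0 N n : 0 <= fejer_weight N n :> R.
Proof. by rewrite divr_ge0. Qed.

Lemma fejer_weight_le1 N n : fejer_weight N n <= 1 :> R.
Proof.
case: N => [|N]; first by rewrite /fejer_weight sub0n mul0r.
by rewrite ler_pdivrMr ?ltr0n // mul1r ler_nat leq_subr.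
Qed.

Lemma fejer_weight_ge N M n : (n < M)%N -> (M <= N)%N ->
  1 - M%:R / N%:R <= fejer_weight N n :> R.
Proof.
move=> nM MN; have N0 : 0 < N%:R :> R by rewrite ltr0n; lia.
rewrite /fejer_weight ler_pdivlMr // mulrBl mul1r divfK ?gt_eqF //.
by rewrite natrB ?lerD2l ?lerN2 ?ler_nat //; lia.
Qed.

(** By Parseval's identity area f is the difference of the two complete sums, so
    this is an equality for the optimal P. The inequality only needs the
    Fejer means of f', which converge uniformly and whose weights lie in
    [0, 1] and increase to 1: the weights are dropped on the positive
    frequencies and bounded below by 1 - M / N on the first M negative ones. *)
Lemma negative_part_le f (P : R) : smooth f -> per f ->
  (forall N, \sum_(n < N) n.+1%:R * normc (fcoef f n.+1) ^+ 2 <= P) ->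
  forall M, \sum_(n < M) n.+1%:R * normc (fcoef f (- n.+1%:Z)) ^+ 2 <= P - area f.
Proof.
move=> sf pf fP M; have sc := smoothC_conj sf.
have [fr fi] := sf; have [C1 C10 C1M] := smooth_bounded (ltW twopi_gt0) fr.
have [C2 C20 C2M] := smooth_bounded (ltW twopi_gt0) fi.
set Q := \sum_(n < M) _.
have Q0 : 0 <= Q by apply: sumr_ge0 => n _; rewrite mulr_ge0 ?sqr_ge0.
suff H (e : R) : 0 < e -> Q <= P - area f + (C1 + C2 + 1) * e.
  apply/ler_addgt0Pr => e e0.
  have C0 : 0 < C1 + C2 + 1 by lra.
  have := H (e / (C1 + C2 + 1)) (divr_gt0 e0 C0).
  by rewrite mulrC divfK // gt_eqF.
move=> e0; have sf' := smoothC_deriveC sf.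
have [N0 N0P] := fejer_cvg sf' (deriveC_per sf pf) e0.
pose N := (maxn N0.+1 (maxn M.+1 (Num.truncn (M%:R * Q / e)).+1)).
have N0N : (N0 < N)%N by rewrite /N; lia.
have MN : (M <= N)%N by rewrite /N; lia.
have NR : 0 < N%:R :> R by rewrite ltr0n; lia.
have NQ : M%:R / N%:R * Q <= e.
  rewrite mulrAC ler_pdivrMr // [leRHS]mulrC -ler_pdivrMr //.
  apply/ltW/(lt_le_trans (truncnS_gt _)); rewrite ler_nat /N.
  by rewrite !leq_max leqnn !orbT.
have sF := @smooth_fejer_sum N (deriveC f).
have dist : area f - Im (avg (fun t => (f t)^* * fejer_sum N (deriveC f) t))
    <= (C1 + C2) * e.
  rewrite /area -ImN -ImD -(avgB (smoothC_mul sc sf') (smoothC_mul sc sF)).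
  apply: (@le_trans _ _ (normc (avg (fun t =>
     (f t)^* * deriveC f t - (f t)^* * fejer_sum N (deriveC f) t)))).
    exact: Im_le_normc.
  apply: (normc_avg_le_cst (smoothC_sub (smoothC_mul sc sf') (smoothC_mul sc sF))).
  move=> t t2; rewrite -mulrBr Normc.normcM normcJ; apply: ler_pM; rewrite ?normc_ge0 //.
    exact: (le_trans (normc_le_ReIm _) (lerD (C1M t t2) (C2M t t2))).
  by rewrite normcB; exact: N0P.
rewrite area_fejer // in dist.
have pos : \sum_(n < N) fejer_weight N n * (n.+1%:R * normc (fcoef f n.+1) ^+ 2) <= P.
  apply: le_trans (fP N); apply: ler_sum => n _.
  by rewrite ler_piMl ?fejer_weight_le1 // mulr_ge0 ?sqr_ge0.
have neg : (1 - M%:R / N%:R) * Q <=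
    \sum_(n < N) fejer_weight N n * (n.+1%:R * normc (fcoef f (- n.+1%:Z)) ^+ 2).
  rewrite -(subnKC MN) big_split_ord /= subnKC // mulr_sumr.
  rewrite -[leLHS]addr0; apply: lerD.
    apply: ler_sum => n _; rewrite ler_wpM2r ?fejer_weight_ge //.
    by rewrite mulr_ge0 ?sqr_ge0.
  by apply: sumr_ge0 => n _; rewrite !mulr_ge0 ?sqr_ge0 ?fejer_weight_ge0.
move: dist; under eq_bigr do rewrite !mulrBr; rewrite sumrB.
rewrite mulrBl mul1r in neg; lra.
Qed.

End FejerConvergence.

(** * Nonstationary phase *)

Section NonstationaryPhase.
Context {R : realType}.
Implicit Types (f g : R -> R[i]) (h : R -> R) (z w : R[i]) (s t : R).
Local Notation Re := (@complex.Re R).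
Local Notation Im := (@complex.Im R).
Local Notation normc := (@Normc.normc R).

Lemma derive1_quasi_per h (c : R) : smooth_real h ->
  (forall t, h (t + 2 * pi) = h t + c) ->
  forall t, (h^`())%classic (t + 2 * pi) = (h^`())%classic t.
Proof.
move=> sh hc t; have dh := smooth_derivable sh.
have := derive1_compE dh (smooth_derivable (smooth_shift (2 * pi))).
under [X in (X^`())%classic]funext => s do rewrite hc.
rewrite (derive1_addc c dh) => /(congr1 (fun q => q t)) ->.
by rewrite derive1_shift mulr1.
Qed.

(** With p = n h' + m the derivative of the phase, integrating by parts twice
    amounts to the identity
      d/dt ((i / p - p' / p^3) e^(- i (n h + m t)))
        = (1 - (p' / p^3)') e^(- i (n h + m t)). *)
Lemma avg_expi_phase h (n m : R) : smooth_real h ->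
  (forall t, h (t + 2 * pi) = h t + 2 * pi) ->
  (forall t, 0 < n * (h^`())%classic t + m) ->
  (forall t, expi (- (n * h (t + 2 * pi) + m * (t + 2 * pi))) =
             expi (- (n * h t + m * t))) ->
  avg (fun t => expi (- (n * h t + m * t))) =
  avg (fun t => ((n * ((h^`())%classic^`())%classic^`()%classic t) /
       (n * (h^`())%classic t + m) ^+ 3
     - 3 * (n * ((h^`())%classic^`())%classic t) ^+ 2 /
       (n * (h^`())%classic t + m) ^+ 4)%:C *
     expi (- (n * h t + m * t))).
Proof.
move=> sh h2 p0 perE; pose p t := n * (h^`())%classic t + m.
set h' := (h^`())%classic; set h'' := (h'^`())%classic; set h3 := (h''^`())%classic.
have sh' : smooth_real h' := smooth_realD1 sh.
have sh'' : smooth_real h'' := smooth_realD1 sh'.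
have sp : smooth_real p := smooth_add (smooth_mul (smooth_cst n) sh') (smooth_cst m).
pose q t := (p t)^-1.
have pn t : p t != 0 by rewrite gt_eqF //; exact: p0.
have sq : smooth_real q := smooth_inv pn sp.
have dscale (c : R) (k : R -> R) : smooth_real k ->
    ((fun t => c * k t)^`())%classic = (fun t => c * (k^`())%classic t).
  move=> sk; have sc := smooth_cst c.
  rewrite (derive1_mul (smooth_derivable sc) (smooth_derivable sk)).
  by apply/funext => t; rewrite derive1_cst mulr0 addr0.
have dp : (p^`())%classic = (fun t => n * h'' t).
  rewrite (derive1_addc m (smooth_derivable (smooth_mul (smooth_cst n) sh'))).
  exact: dscale.
have dq : (q^`())%classic = (fun t => - (n * h'' t) * (q t * q t)).
  have pq : (fun t => p t * q t) = fun=> 1 by apply/funext => t; rewrite mulfV.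
  have := derive1_mul (smooth_derivable sp) (smooth_derivable sq).
  rewrite pq dp => e; apply/funext => t.
  have := congr1 (fun k => k t) e; rewrite /= derive1_cst => et.
  apply: (mulfI (pn t)); rewrite -[LHS]addr0 -[X in _ = X]addr0.
  have -> : p t * (- (n * h'' t) * (q t * q t)) = - (q t * (n * h'' t)) * (p t * q t).
    by ring.
  by rewrite mulfV // mulr1 !addr0; lra.
pose r t := n * h'' t * (q t * (q t * q t)).
have snh : smooth_real (fun t => n * h'' t) := smooth_mul (smooth_cst n) sh''.
have sqq := smooth_mul sq sq; have sqqq := smooth_mul sq sqq.
have sr : smooth_real r := smooth_mul snh sqqq.
have dr : (r^`())%classic = (fun t => n * h3 t / p t ^+ 3 - 3 * (n * h'' t) ^+ 2 / p t ^+ 4).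
  rewrite (derive1_mul (smooth_derivable snh) (smooth_derivable sqqq)).
  rewrite (derive1_mul (smooth_derivable sq) (smooth_derivable sqq)).
  rewrite (derive1_mul (smooth_derivable sq) (smooth_derivable sq)) dq (dscale _ _ sh'').
  by apply/funext => t; rewrite -/h3 /q; field; exact: pn.
pose ph t := - (n * h t + m * t).
have snm := smooth_add (smooth_mul (smooth_cst n) sh) (smooth_mul (smooth_cst m) smooth_id).
have sph : smooth_real ph := smooth_opp snm.
have dph : (ph^`())%classic = (fun t => - p t).
  rewrite (derive1_opp (smooth_derivable snm)).
  rewrite (derive1_add (smooth_derivable (smooth_mul (smooth_cst n) sh))
    (smooth_derivable (smooth_mul (smooth_cst m) smooth_id))).
  by rewrite derive1_linear (dscale _ _ sh).
pose W t : R[i] := (- r t) +i* q t.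
have sW : smooth W := conj (smooth_opp sr) sq.
have dW t : deriveC W t = (- (r^`())%classic t) +i* (q^`())%classic t.
  by rewrite /deriveC /= (derive1_opp (smooth_derivable sr)).
have sE := smooth_expi_comp sph.
have sF := smoothC_mul sW sE.
have h'2 := derive1_quasi_per sh h2; have h''2 t : h'' (t + 2 * pi) = h'' t.
  by apply: (derive1_quasi_per (c := 0) sh') => s; rewrite addr0; exact: h'2.
have pF : per (fun t => W t * expi (ph t)).
  by move=> t; rewrite /ph perE /W /r /q /p h'2 h''2.
have srE := smoothC_mul (smoothC_real (smooth_realD1 sr)) sE.
have := avg_deriveC_per sF pF.
have -> : deriveC (fun t => W t * expi (ph t)) =
    (fun t => expi (ph t) - ((r^`())%classic t)%:C * expi (ph t)).
  rewrite (deriveC_mul sW sE) (deriveC_expi_comp sph) dph; apply/funext => t.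
  rewrite dW dq; have e : p t * q t = 1 by rewrite mulfV.
  have e2 : p t * r t = n * h'' t * (q t * q t) by rewrite /r -[RHS]mulr1 -e; ring.
  rewrite -[X in _ = X - _]mul1r -mulrBl [W t * _]mulrA -mulrDl; congr (_ * _).
  apply: complexP; rewrite /W !ReImE /=.
    by rewrite -[X in _ = X - _]e; ring.
  by move: e2; lra.
rewrite (avgB sE srE) => /eqP; rewrite subr_eq0 => /eqP ->.
by rewrite dr.
Qed.

(** The derivative p = n h' + m of the phase is at least c (n + m) with
    c = min (inf h', 1), while p' and p'' are O(n), so that both terms of the
    twice integrated amplitude are O((n + m)^-2). *)
Lemma nonstationary_phase h : smooth_real h -> (forall t, 0 < (h^`())%classic t) ->
  (forall t, h (t + 2 * pi) = h t + 2 * pi) ->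
  exists2 K : R, 0 <= K & forall n m : nat, (0 < n)%N -> (0 < m)%N ->
    normc (avg (fun t => expi (- (n%:R * h t + m%:R * t)))) <= K / (n + m)%:R ^+ 2.
Proof.
move=> sh h0 h2; have sh' := smooth_realD1 sh; have sh'' := smooth_realD1 sh'.
have tp := ltW (@twopi_gt0 R).
have [c1 c10 c1P] := smooth_pos_min tp sh' h0.
have [M1 M10 M1P] := smooth_bounded tp sh''.
have [M2 M20 M2P] := smooth_bounded tp (smooth_realD1 sh'').
pose c := Num.min c1 1; have c0 : 0 < c by rewrite lt_min c10 ltr01.
have cc1 : c <= c1 by rewrite ge_min lexx.
have cle1 : c <= 1 by rewrite ge_min lexx orbT.
exists (M2 / c ^+ 3 + 3 * M1 ^+ 2 / c ^+ 4).
  by apply: addr_ge0; apply: divr_ge0; rewrite ?mulr_ge0 ?exprn_ge0 // ltW.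
move=> n m n0 m0; have nR : 0 < n%:R :> R by rewrite ltr0n.
have mR : 0 < m%:R :> R by rewrite ltr0n.
have p0 t : 0 < n%:R * (h^`())%classic t + m%:R by rewrite addr_gt0 // mulr_gt0.
rewrite (avg_expi_phase sh h2 p0); last first.
  move=> t; rewrite h2.
  have -> : - (n%:R * (h t + 2 * pi) + m%:R * (t + 2 * pi)) =
      - (n%:R * h t + m%:R * t) + - ((n%:R + m%:R) * (2 * pi)) by ring.
  rewrite expiD.
  have -> : - ((n%:R + m%:R) * (2 * pi)) = (- (n + m)%:Z)%:~R * (2 * pi) :> R.
    by rewrite mulrNz mulNr -natrD.
  have -> : expi ((- (n + m)%:Z)%:~R * (2 * pi)) = 1 :> R[i].
    by rewrite -expi_exprz -[2 * pi]add0r expi_periodic expi0 exp1rz.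
  by rewrite mulr1.
set h' := (h^`())%classic; set h'' := (h'^`())%classic; set h3 := (h''^`())%classic.
set L : R := (n + m)%:R; have L0 : 0 < L by rewrite ltr0n addn_gt0 n0.
have sp : smooth_real (fun t => n%:R * h' t + m%:R).
  exact (smooth_add (smooth_mul (smooth_cst _) sh') (smooth_cst _)).
have pn t : n%:R * h' t + m%:R != 0 by rewrite gt_eqF.
have sq := smooth_inv pn sp.
apply: normc_avg_le_cst.
  apply: smoothC_mul; last first.
    apply: smooth_expi_comp; apply: smooth_opp.
    exact (smooth_add (smooth_mul (smooth_cst _) sh) (smooth_mul (smooth_cst _) smooth_id)).
  apply: smoothC_real.
  have sX k : smooth_real (fun t => (n%:R * h' t + m%:R) ^- k).
    elim: k => [|k IHk].
      by apply: (smooth_ext _ (smooth_cst 1)) => t; rewrite expr0 invr1.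
    by apply: (smooth_ext _ (smooth_mul sq IHk)) => t; rewrite exprS invfM.
  have s1 := smooth_mul (smooth_cst n%:R) (smooth_realD1 sh'').
  have s2 := smooth_mul (smooth_cst n%:R) sh''.
  exact (smooth_sub (smooth_mul s1 (sX 3%N))
    (smooth_mul (smooth_mul (smooth_cst 3) (smooth_mul s2 s2)) (sX 4%N))).
move=> t t2; rewrite Normc.normcM normc_expi mulr1 normc_real.
set p := n%:R * h' t + m%:R.
have pL : c * L <= p.
  rewrite /p /L natrD mulrDr; apply: lerD.
    by rewrite mulrC ler_wpM2l ?(ltW nR) // (le_trans cc1) ?c1P.
  by rewrite ler_piMl ?(ltW mR).
have cL : 0 < c * L by rewrite mulr_gt0.
have nL : n%:R <= L by rewrite ler_nat leq_addr.
have pk k : (p ^+ k)^-1 <= ((c * L) ^+ k)^-1.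
  by rewrite lef_pV2 ?posrE ?exprn_gt0 // ?(lt_le_trans cL) // lerXn2r ?nnegrE // ltW // (lt_le_trans cL).
have pk0 k : 0 <= (p ^+ k)^-1 by rewrite invr_ge0 exprn_ge0 // ltW // (lt_le_trans cL).
clearbody L c.
apply: (le_trans (ler_normB _ _)); rewrite [leRHS]mulrDl; apply: lerD.
  rewrite normrM [X in _ * X]ger0_norm // normrM ger0_norm ?(ltW nR) //.
  apply: (@le_trans _ _ (L * M2 * ((c * L) ^+ 3)^-1)).
    have H : n%:R * `|h3 t| <= L * M2 by apply: ler_pM; rewrite ?(ltW nR) ?M2P.
    by apply: (ler_pM _ _ H (pk 3%N)); rewrite ?mulr_ge0 // ltW.
  by rewrite le_eqVlt; apply/orP; left; apply/eqP; field; rewrite !gt_eqF.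
rewrite normrM [X in _ * X]ger0_norm // normrM ger0_norm // normrX normrM ger0_norm ?(ltW nR) //.
apply: (@le_trans _ _ (3 * (L * M1) ^+ 2 * ((c * L) ^+ 4)^-1)).
  have H : n%:R * `|h'' t| <= L * M1 by apply: ler_pM; rewrite ?(ltW nR) ?M1P.
  have n0h : 0 <= n%:R * `|h'' t| by rewrite mulr_ge0.
  apply: ler_pM; rewrite ?pk ?pk0 ?mulr_ge0 ?exprn_ge0 //.
  by rewrite ler_pM2l // lerXn2r // nnegrE (le_trans n0h).
by rewrite le_eqVlt; apply/orP; left; apply/eqP; field; rewrite !gt_eqF.
Qed.

End NonstationaryPhase.

(** * Sums with the weights of the H^(1/2) norm *)

Section HalfSobolevBound.
Context {R : realType}.
Implicit Types (f g : R -> R[i]) (h : R -> R) (z w : R[i]) (s t : R).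
Implicit Types (u v : circle R -> R[i]) (psi : circle_bij R) (a : int -> R[i]).
Local Notation Re := (@complex.Re R).
Local Notation Im := (@complex.Im R).
Local Notation normc := (@Normc.normc R).

Lemma discriminant_le (X Y Z : R) : 0 <= Y ->
  (forall l : R, 0 <= X - 2 * l * Z + l ^+ 2 * Y) -> Z ^+ 2 <= X * Y.
Proof.
rewrite le_eqVlt => /orP[/eqP <- H|Y0 H].
  rewrite mulr0; have [->|Z0] := eqVneq Z 0; first by rewrite expr0n.
  have := H ((X + 1) / (2 * Z)); rewrite mulr0 addr0.
  rewrite (_ : 2 * _ * Z = X + 1); last by field.
  lra.
have := H (Z / Y); rewrite (_ : _ + _ = (X * Y - Z ^+ 2) / Y); last first.
  by field; rewrite gt_eqF.
by rewrite pmulr_lge0 ?invr_gt0 // subr_ge0.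
Qed.

Lemma weighted_cauchy_schwarz (N : nat) (wt b x : nat -> R) : (forall n, 0 < wt n) ->
  (\sum_(n < N) b n * x n) ^+ 2 <=
  (\sum_(n < N) wt n * b n ^+ 2) * (\sum_(n < N) x n ^+ 2 / wt n).
Proof.
move=> wt0; apply: discriminant_le.
  by apply: sumr_ge0 => n _; rewrite divr_ge0 ?sqr_ge0 // ltW.
move=> l; rewrite !mulr_sumr -sumrB -big_split /=; apply: sumr_ge0 => n _.
rewrite (_ : _ + _ = wt n * (b n - l * x n / wt n) ^+ 2).
  by rewrite mulr_ge0 ?sqr_ge0 // ltW.
by field; rewrite gt_eqF.
Qed.

Lemma sum_inv_sqr_le2 (N : nat) : \sum_(n < N) (n.+1%:R ^+ 2)^-1 <= 2 :> R.
Proof.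
suff H : \sum_(n < N.+1) (n.+1%:R ^+ 2)^-1 <= 2 - N.+1%:R^-1 :> R.
  apply: (@le_trans _ _ (\sum_(n < N.+1) (n.+1%:R ^+ 2)^-1)).
    by rewrite big_ord_recr /= lerDl invr_ge0 sqr_ge0.
  by apply: (le_trans H); rewrite gerBl invr_ge0.
elim: N => [|N IHN]; first by rewrite big_ord1 expr1n invr1; lra.
rewrite big_ord_recr /=; apply: (le_trans (lerD IHN (lexx _))).
have N1 : 0 < N.+1%:R :> R by rewrite ltr0n.
rewrite -[N.+2%:R]natr1; set y : R := N.+1%:R; rewrite -/y in N1.
rewrite -subr_ge0 (_ : _ - _ = (y * (y + 1) ^+ 2)^-1).
  by rewrite invr_ge0 mulr_ge0 ?sqr_ge0 // ltW.
clearbody y; by field; rewrite !gt_eqF // addr_gt0.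
Qed.

(** The partial sums of the squared norm over the positive, respectively the
    negative, frequencies. *)
Definition Hpos (M : nat) a : R := \sum_(m < M) m.+1%:R * normc (a m.+1) ^+ 2.
Definition Hneg (M : nat) a : R := \sum_(m < M) m.+1%:R * normc (a (- m.+1%:Z)) ^+ 2.

Lemma decay_weight (K e : R) (n m : nat) : 0 <= e <= K / (n.+1 + m.+1)%:R ^+ 2 ->
  m.+1%:R * (e ^+ 2 / n.+1%:R) <= K ^+ 2 * ((m.+1%:R ^+ 2)^-1 * (n.+1%:R ^+ 2)^-1).
Proof.
move=> /andP[E0 E1]; have n1 k : 0 < k.+1%:R :> R by rewrite ltr0n.
have /(ler_wpM2r (ltW (n1 m))) : e ^+ 2 / n.+1%:R <=
    (K / (n.+1 + m.+1)%:R ^+ 2) ^+ 2 / n.+1%:R.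
  by rewrite ler_pM2r ?invr_gt0 // lerXn2r // nnegrE // (le_trans E0).
rewrite mulrC => /le_trans; apply; rewrite natrD.
have := n1 m; have := n1 n; set x : R := n.+1%:R; set y : R := m.+1%:R.
clearbody x y => x0 y0.
have xy0 : 0 < x + y by rewrite addr_gt0.
have -> : (K / (x + y) ^+ 2) ^+ 2 / x * y = K ^+ 2 * (y / (x * (x + y) ^+ 4)).
  by field; rewrite !gt_eqF.
apply: ler_wpM2l; first exact: sqr_ge0.
rewrite -subr_ge0 (_ : _ - _ =
  ((x + y) ^+ 4 - y ^+ 3 * x) / (x ^+ 2 * y ^+ 2 * (x + y) ^+ 4)); last first.
  by field; rewrite !gt_eqF.
apply: divr_ge0; last by rewrite !mulr_ge0 ?exprn_ge0 // ltW.
rewrite (_ : _ - _ = x ^+ 4 + 4 * x ^+ 3 * y + 6 * x ^+ 2 * y ^+ 2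
  + 3 * x * y ^+ 3 + y ^+ 4); last by ring.
by rewrite !addr_ge0 // ?mulr_ge0 ?exprn_ge0 // ltW.
Qed.

(** Cauchy's inequality with weights n, and (n + m)^4 >= m^3 n, reduce the claim
    to the convergence of the double sum of m^-2 n^-2. *)
Lemma decaying_matrix_bound (K : R) (E : nat -> nat -> R) (b : nat -> R) (N M : nat) :
  0 <= K -> (forall n, 0 <= b n) ->
  (forall n m, 0 <= E n m <= K / (n.+1 + m.+1)%:R ^+ 2) ->
  \sum_(m < M) m.+1%:R * (\sum_(n < N) b n * E n m) ^+ 2 <=
  4 * K ^+ 2 * \sum_(n < N) n.+1%:R * b n ^+ 2.
Proof.
move=> K0 b0 EK; set S := \sum_(n < N) n.+1%:R * b n ^+ 2.
have S0 : 0 <= S by apply: sumr_ge0 => n _; rewrite mulr_ge0 ?sqr_ge0.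
have n1 (n : nat) : 0 < n.+1%:R :> R by rewrite ltr0n.
have row (m : nat) : m.+1%:R * (\sum_(n < N) b n * E n m) ^+ 2 <=
    S * (K ^+ 2 * ((m.+1%:R ^+ 2)^-1 * 2)).
  have := weighted_cauchy_schwarz N b (E^~ m) n1; rewrite -/S.
  move=> /(ler_wpM2l (ltW (n1 m))) /le_trans; apply.
  rewrite mulrCA; apply: ler_wpM2l => //; rewrite mulr_sumr.
  apply: (@le_trans _ _ (K ^+ 2 * ((m.+1%:R ^+ 2)^-1 * \sum_(n < N) (n.+1%:R ^+ 2)^-1))).
    by rewrite !mulr_sumr; apply: ler_sum => n _; exact: decay_weight.
  apply: ler_wpM2l; first exact: sqr_ge0.
  by apply: ler_wpM2l (sum_inv_sqr_le2 N); rewrite invr_ge0 sqr_ge0.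
apply: (@le_trans _ _ (\sum_(m < M) S * (K ^+ 2 * ((m.+1%:R ^+ 2)^-1 * 2)))).
  by apply: ler_sum => m _; exact: row.
rewrite -!mulr_sumr -mulr_suml.
have -> : 4 * K ^+ 2 * S = S * (K ^+ 2 * (2 * 2)) by ring.
apply: ler_wpM2l => //; apply: ler_wpM2l; first exact: sqr_ge0.
by apply: ler_wpM2r (sum_inv_sqr_le2 M).
Qed.

(** * The action on trigonometric polynomials *)

Definition neg_poly (N : nat) (b : nat -> R[i]) : circle R -> R[i] :=
  fun c => \sum_(n < N) b n * expz (- n.+1%:Z) c.

Lemma smooth_scale_expz z n : smooth_fun (fun c => z * expz n c).
Proof. by have se := @smooth_expz R n; exact (smoothC_mul (smoothC_cst z) se). Qed.

Lemma smooth_neg_poly N b : smooth_fun (neg_poly N b).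
Proof. exact (smoothC_sum _ (fun (n : 'I_N) _ => smooth_scale_expz (b n) (- n.+1%:Z))). Qed.

Lemma Hspace_neg_poly N b : Hspace (neg_poly N b).
Proof.
apply: (@Hspace_sum R _ _ _ (fun (n : 'I_N) c => b n * expz (- n.+1%:Z) c)) => n _.
by apply/HspaceZ/Hspace_expz; rewrite oppr_eq0.
Qed.

Lemma fourier_neg_poly N b (n : 'I_N) : fourier (neg_poly N b) (- n.+1%:Z) = b n.
Proof.
rewrite (@fourier_sum R _ _ _ (fun (n : 'I_N) c => b n * expz (- n.+1%:Z) c)); last first.
  by move=> i _; exact: smooth_scale_expz.
rewrite (bigD1 n) //= big1 ?addr0 => [|i ni].
  by rewrite fourierZ ?fourier_expz ?eqxx ?mulr1 //; exact: smooth_expz.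
rewrite fourierZ ?fourier_expz; last exact: smooth_expz.
rewrite eqr_opp (_ : (_ == _) = false) ?mulr0 //; apply/negbTE.
by apply: contra ni => /eqP [e]; apply/eqP/val_inj.
Qed.

(** This is how the symplectic form controls the difference between the
    positive and the negative part of the norm. *)
Lemma area_omega v : area (v \o cis) = Im (omega (conj_fun v) v).
Proof. by []. Qed.

Lemma area_neg_poly N b :
  area (neg_poly N b \o cis) = - \sum_(n < N) n.+1%:R * normc (b n) ^+ 2.
Proof.
set T := neg_poly N b; have sT : smooth (T \o cis) := smooth_neg_poly N b.
have sc := smoothC_conj sT.
pose c (n : nat) : R[i] := b n * ('i * (- n.+1%:R)%:C).
have dT : deriveC (T \o cis) = (fun t => \sum_(n < N) c n * expi (- n.+1%:R * t)).
  have -> : T \o cis = (fun t => \sum_(n < N) b n * expi (- n.+1%:R * t)).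
    apply/funext => t; rewrite /T /= /neg_poly; apply: eq_bigr => n _.
    by rewrite expz_cis mulrNz.
  have sE n : smooth (fun t => b n * expi (- n.+1%:R * t)).
    by have se := @smooth_expi_linear R (- n.+1%:R); exact (smoothC_mul (smoothC_cst _) se).
  elim: (N) => [|k IHk].
    by under eq_fun do rewrite big_ord0; rewrite deriveC_cst; apply/funext => t; rewrite big_ord0.
  under eq_fun do rewrite big_ord_recr /=.
  rewrite (deriveC_add (smoothC_sum _ (fun (n : 'I_k) _ => sE n)) (sE k)) IHk.
  rewrite (deriveC_scale _ (smooth_expi_linear _)) deriveC_expi_linear.
  by apply/funext => t; rewrite big_ord_recr /= mulrA.
rewrite /area dT; under eq_fun do rewrite mulr_sumr.
have sG n : smooth (fun t => (T (cis t))^* * (c n * expi (- n.+1%:R * t))).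
  exact (smoothC_mul sc (smoothC_mul (smoothC_cst _) (smooth_expi_linear _))).
rewrite (avg_sum _ (fun (n : 'I_N) _ => sG n)) (big_morph Im (@ImD R) (erefl : Im 0 = 0)).
rewrite -sumrN; apply: eq_bigr => n _.
under eq_fun do rewrite mulrCA.
rewrite (avgZ _ (smooth_fcoef _ sc)) (avg_conj_expi _ sT) opprK.
have -> : avg (fun t => (T \o cis) t * expi (n.+1%:R * t)) = b n.
  by rewrite -(fourier_neg_poly b n) fourierE.
rewrite /c normc_sqr; case: (b n) => x y; rewrite !ReImE /=; ring.
Qed.

End HalfSobolevBound.

(** * The action of a diffeomorphism is bounded *)

Section DiffeoBound.
Context {R : realType}.
Implicit Types (f g : R -> R[i]) (h : R -> R) (z w : R[i]) (s t : R).
Implicit Types (u v : circle R -> R[i]) (psi : circle_bij R) (a : int -> R[i]).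
Local Notation Re := (@complex.Re R).
Local Notation Im := (@complex.Im R).
Local Notation normc := (@Normc.normc R).

Definition Hsum (M : nat) a : R := Hpos M a + Hneg M a.

Lemma Hpos_ge0 M a : 0 <= Hpos M a.
Proof. by apply: sumr_ge0 => m _; rewrite mulr_ge0 ?sqr_ge0. Qed.

Lemma Hneg_ge0 M a : 0 <= Hneg M a.
Proof. by apply: sumr_ge0 => m _; rewrite mulr_ge0 ?sqr_ge0. Qed.

Lemma normc_sqrD z w : normc (z + w) ^+ 2 <= 2 * normc z ^+ 2 + 2 * normc w ^+ 2.
Proof.
rewrite !normc_sqr !ReImE; have := sqr_ge0 (Re z - Re w); have := sqr_ge0 (Im z - Im w).
lra.
Qed.

Lemma Hsum_add M a b c : (forall m, m != 0 -> a m = b m + c m) ->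
  Hsum M a <= 2 * Hsum M b + 2 * Hsum M c.
Proof.
move=> abc; rewrite /Hsum !mulrDr addrACA; apply: lerD.
  rewrite /Hpos !mulr_sumr -big_split /=; apply: ler_sum => m _.
  rewrite abc // (le_trans (ler_wpM2l _ (normc_sqrD _ _))) //.
  by rewrite le_eqVlt; apply/orP; left; apply/eqP; ring.
rewrite /Hneg !mulr_sumr -big_split /=; apply: ler_sum => m _.
rewrite abc ?oppr_eq0 // (le_trans (ler_wpM2l _ (normc_sqrD _ _))) //.
by rewrite le_eqVlt; apply/orP; left; apply/eqP; ring.
Qed.

Lemma Hsum_small M a (e : R) : (forall m, m != 0 -> normc (a m) <= e) ->
  Hsum M a <= 2 * (\sum_(m < M) m.+1%:R) * e ^+ 2.
Proof.
move=> ae; rewrite [2 * _]mulr_natl mulr2n mulrDl.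
have b m : m != 0 -> normc (a m) ^+ 2 <= e ^+ 2.
  move=> m0; have := ae _ m0 => H; rewrite lerXn2r // ?nnegrE ?normc_ge0 //.
  exact: le_trans (normc_ge0 _) H.
apply: lerD; rewrite mulr_suml; apply: ler_sum => m _; rewrite ler_wpM2l ?b //.
Qed.

Lemma Hsum_conj M v : smooth_fun v -> Hsum M (fourier (conj_fun v)) = Hsum M (fourier v).
Proof.
move=> sv; have E n : normc (fourier (conj_fun v) n) = normc (fourier v (- n)).
  by rewrite (fourier_conj n sv) normcJ.
rewrite /Hsum [LHS]addrC; congr (_ + _); apply: eq_bigr => m _.
  by rewrite (E (- m.+1%:Z)) opprK.
by rewrite (E m.+1%:Z).
Qed.

Lemma fourier_Phi psi u (m : int) : m != 0 -> smooth_map (cb_inv psi) -> smooth_fun u ->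
  fourier (Phi psi u) m = avg (fun t => u (cb_inv psi (cis t)) * expi ((- m)%:~R * t)).
Proof.
move=> m0 sp su; have s := smooth_pullback sp su; rewrite fourierE /Phi.
under eq_fun do rewrite mulrBl.
have se := @smooth_expi_linear R (- m)%:~R.
rewrite (avgB (smooth_fcoef _ s) (smoothC_mul (smoothC_cst _) se)) (avgZ _ se).
by rewrite avg_expi oppr_eq0 (negbTE m0) mulr0 subr0.
Qed.

Lemma fourier_Phi_le psi u (e : R) (m : int) : m != 0 -> smooth_map (cb_inv psi) ->
  smooth_fun u -> (forall c, normc (u c) <= e) -> normc (fourier (Phi psi u) m) <= e.
Proof.
move=> m0 sp su ue; rewrite fourier_Phi //.
apply: normc_avg_le_cst; first exact (smooth_fcoef _ (smooth_pullback sp su)).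
by move=> t _; rewrite Normc.normcM normc_expi mulr1.
Qed.

Lemma fourier_PhiD psi u v (m : int) : m != 0 -> smooth_map (cb_inv psi) ->
  smooth_fun u -> smooth_fun v ->
  fourier (Phi psi (fun c => u c + v c)) m = fourier (Phi psi u) m + fourier (Phi psi v) m.
Proof.
move=> m0 sp su sv; have s1 := smooth_fcoef (- m)%:~R (smooth_pullback sp su).
have s2 := smooth_fcoef (- m)%:~R (smooth_pullback sp sv).
rewrite (fourier_Phi m0 sp (smoothC_add su sv : smooth_fun _)).
rewrite (fourier_Phi m0 sp su) (fourier_Phi m0 sp sv) -(avgD s1 s2).
by congr avg; apply/funext => t; rewrite mulrDl.
Qed.

Lemma fourier_Phi_neg_poly psi N b (m : int) : m != 0 -> smooth_map (cb_inv psi) ->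
  fourier (Phi psi (neg_poly N b)) m =
  \sum_(n < N) b n * fourier (Phi psi (expz (- n.+1%:Z))) m.
Proof.
move=> m0 sp; have sE n := smooth_fcoef (- m)%:~R (smooth_pullback sp (@smooth_expz R n)).
rewrite (fourier_Phi m0 sp (@smooth_neg_poly R N b)).
under eq_bigr do rewrite (fourier_Phi m0 sp (@smooth_expz R _)) -(avgZ _ (sE _)).
rewrite -avg_sum; last by move=> n _; exact (smoothC_mul (smoothC_cst _) (sE _)).
congr avg; apply/funext => t; rewrite /neg_poly mulr_suml.
by apply: eq_bigr => n _; rewrite mulrA.
Qed.

(** The phase n h + m t of this Fourier coefficient has no critical point, because
    h' > 0 and n, m have the same sign; this is what makes the off-diagonal
    block pi^+ Phi pi^- small. *)
Lemma Phi_expz_decay psi : Diff_circle psi -> exists2 K : R, 0 <= K &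
  forall n m : nat, normc (fourier (Phi psi (expz (- n.+1%:Z))) m.+1) <=
    K / (n.+1 + m.+1)%:R ^+ 2.
Proof.
move=> D; have [h [sh hE h0 h2]] := inverse_lift D; case: D => _ si _.
have [K K0 KP] := nonstationary_phase sh h0 h2; exists K => // n m.
apply: le_trans (KP n.+1 m.+1 isT isT).
rewrite (fourier_Phi _ si (@smooth_expz R _)) //.
suff -> : (fun t => expz (- n.+1%:Z) (cb_inv psi (cis t)) * expi ((- m.+1%:Z)%:~R * t)) =
    (fun t => expi (- (n.+1%:R * h t + m.+1%:R * t))) by [].
apply/funext => t; rewrite hE expz_cis -expiD; congr expi.
by rewrite !mulrNz /=; ring.
Qed.

Lemma Phi_conj_fun psi u : smooth_map (cb_inv psi) -> smooth_fun u ->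
  Phi psi (conj_fun u) = conj_fun (Phi psi u).
Proof.
move=> si su; apply/funext => c; have s := smooth_pullback si su.
by rewrite /conj_fun /Phi conjcB -(avg_conj s).
Qed.

Lemma area_Phi psi u : Diff_circle psi -> Hspace u ->
  area (Phi psi u \o cis) = area (u \o cis).
Proof.
move=> D Hu; have [_ si _] := D.
rewrite (area_omega (Phi psi u)) -(Phi_conj_fun si (proj1 Hu)).
by rewrite (omega_Phi D (Hspace_conj Hu) Hu) (area_omega u).
Qed.

(** On negative frequencies the positive part of the image is controlled by
    the decay of the matrix entries; as the form omega, that is the area, is
    preserved, so is the negative part. *)
Lemma Phi_neg_poly_bound psi : Diff_circle psi -> exists2 C : R, 0 <= C &
  forall N b M, Hsum M (fourier (Phi psi (neg_poly N b))) <=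
    C * \sum_(n < N) n.+1%:R * normc (b n) ^+ 2.
Proof.
move=> D; have [K K0 KP] := Phi_expz_decay D; have [_ si _] := D.
exists (8 * K ^+ 2 + 1); first by rewrite addr_ge0 // mulr_ge0 // sqr_ge0.
move=> N b M; set S := \sum_(n < N) _; set T := neg_poly N b.
have HT : Hspace T := Hspace_neg_poly N b.
have HAT : Hspace (Phi psi T) := Phi_Hspace si (proj1 HT).
have pos M' : Hpos M' (fourier (Phi psi T)) <= 4 * K ^+ 2 * S.
  apply: le_trans (@decaying_matrix_bound R K
    (fun n m => normc (fourier (Phi psi (expz (- n.+1%:Z))) m.+1))
    (fun n => normc (b n)) N M' K0 _ _); last 2 first.
  - by move=> n; exact: normc_ge0.
  - by move=> n m; rewrite normc_ge0 KP.
  apply: ler_sum => m _; rewrite ler_wpM2l // lerXn2r ?nnegrE ?normc_ge0 //.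
    by apply: sumr_ge0 => n _; rewrite mulr_ge0 ?normc_ge0.
  rewrite fourier_Phi_neg_poly //.
  elim/big_rec2: _ => [|n x y _ xy]; first by rewrite Normc.normc0.
  by apply: (le_trans (normc_add _ _)); rewrite Normc.normcM lerD2l.
have Phi_area : area (Phi psi T \o cis) = - S.
  by rewrite (area_Phi D HT) (area_neg_poly N b).
have neg : Hneg M (fourier (Phi psi T)) <= 4 * K ^+ 2 * S + S.
  rewrite -[X in _ <= _ + X]opprK -Phi_area /Hneg.
  under eq_bigr do rewrite fourier_fcoef.
  apply: (negative_part_le (proj1 HAT) (per_cis _)) => M'.
  by have := pos M'; rewrite /Hpos; under eq_bigr do rewrite fourier_fcoef.
by rewrite /Hsum; apply: le_trans (lerD (pos M) neg) _; rewrite le_eqVlt; apply/orP;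
  left; apply/eqP; ring.
Qed.

(** Written as the conjugate of a polynomial in negative frequencies, since the
    action commutes with conjugation. *)
Definition pos_poly (N : nat) (b : nat -> R[i]) := conj_fun (neg_poly N (fun n => (b n)^*)).

Lemma Phi_pos_poly_bound psi : Diff_circle psi -> exists2 C : R, 0 <= C &
  forall N b M, Hsum M (fourier (Phi psi (pos_poly N b))) <=
    C * \sum_(n < N) n.+1%:R * normc (b n) ^+ 2.
Proof.
move=> D; have [C C0 CP] := Phi_neg_poly_bound D; exists C; first exact: C0.
move=> N b M.
have [_ si _] := D; set T := neg_poly N (fun n => (b n)^*).
have HT : Hspace T := Hspace_neg_poly N _.
rewrite (Phi_conj_fun si (proj1 HT)) (Hsum_conj M (proj1 (Phi_Hspace si (proj1 HT)))).
by apply: (le_trans (CP _ _ _)); under eq_bigr do rewrite normcJ.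
Qed.

Lemma pos_poly_cis N b t :
  pos_poly N b (cis t) = \sum_(n < N) b n * expi (n.+1%:R * t).
Proof.
rewrite /pos_poly /conj_fun /neg_poly conjc_sum; apply: eq_bigr => n _.
by rewrite conjcM conjcK expz_cis -expiN mulrNz mulNr opprK.
Qed.

Lemma neg_poly_cis N b t :
  neg_poly N b (cis t) = \sum_(n < N) b n * expi (- n.+1%:R * t).
Proof. by rewrite /neg_poly; apply: eq_bigr => n _; rewrite expz_cis mulrNz. Qed.

Lemma fejer_sum_poly N u t : avg (u \o cis) = 0 ->
  fejer_sum N (u \o cis) t =
  neg_poly N (fun n => (fejer_weight N n)%:C * fourier u (- n.+1%:Z)) (cis t) +
  pos_poly N (fun n => (fejer_weight N n)%:C * fourier u n.+1) (cis t).
Proof.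
move=> u0; rewrite /fejer_sum fcoef0 u0 add0r neg_poly_cis pos_poly_cis -big_split.
by apply: eq_bigr => n _; rewrite !fourier_fcoef mulrDr addrC !mulrA.
Qed.

Lemma le_of_splittings (x y r p q X Y1 Y2 : R) : x <= 2 * y + 2 * r -> y <= 2 * p + 2 * q ->
  r <= X -> p <= Y1 -> q <= Y2 -> x <= 4 * (Y1 + Y2) + 2 * X.
Proof. lra. Qed.

(** The Fejer means of u have smaller coefficients than u, so the previous bounds
    apply to them; as they converge uniformly to u, each coefficient of
    their images converges, which suffices for finite sums. *)
Lemma Phi_Hsum_bound psi : Diff_circle psi -> exists2 C : R, 0 <= C &
  forall u, Hspace u -> forall S, (forall N, Hsum N (fourier u) <= S) ->
    forall M, Hsum M (fourier (Phi psi u)) <= C * S.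
Proof.
move=> D; have [C1 C10 C1P] := Phi_neg_poly_bound D.
have [C2 C20 C2P] := Phi_pos_poly_bound D; have [_ si _] := D.
exists (4 * (C1 + C2)); first by rewrite mulr_ge0 // addr_ge0.
move=> u [su u0] S uS M.
pose W : R := 4 * \sum_(m < M) m.+1%:R.
have W0 : 0 <= W by rewrite mulr_ge0 // sumr_ge0.
suff H (e : R) : 0 < e -> Hsum M (fourier (Phi psi u)) <= 4 * (C1 + C2) * S + W * e ^+ 2.
  apply/ler_addgt0Pr => e e0.
  have q0 : 0 < e / (W + 1) by rewrite divr_gt0 // ltr_wpDl.
  have := H (Num.sqrt (e / (W + 1))); rewrite sqrtr_gt0 sqr_sqrtr ?(ltW q0) //.
  move=> /(_ q0) /le_trans; apply; rewrite lerD2l mulrA ler_pdivrMr ?ltr_wpDl //.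
  by rewrite mulrC ler_pM2l // lerDl.
move=> e0; have [N0 N0P] := fejer_cvg su (per_cis u) e0.
pose N := N0.+1; have {N0P} NP := N0P N (leqnn _).
pose b1 n := (fejer_weight N n)%:C * fourier u (- n.+1%:Z).
pose b2 n := (fejer_weight N n)%:C * fourier u n.+1.
pose T c := neg_poly N b1 c + pos_poly N b2 c.
have s1 : smooth_fun (neg_poly N b1) := @smooth_neg_poly R _ _.
have s2 : smooth_fun (pos_poly N b2) := smoothC_conj (@smooth_neg_poly R _ _).
have sT : smooth_fun T := smoothC_add s1 s2.
have sB : smooth_fun (fun c => u c - T c) := smoothC_sub su sT.
have close c : normc (u c - T c) <= e.
  have [t t2 <-] := cis_surj c; rewrite normcB /T -fejer_sum_poly //.
  exact: NP.
have weight n z : normc ((fejer_weight N n)%:C * z) ^+ 2 <= normc z ^+ 2.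
  rewrite Normc.normcM normc_real ger0_norm ?fejer_weight_ge0 // exprMn.
  by rewrite ler_piMl ?sqr_ge0 // exprn_ile1 ?fejer_weight_ge0 ?fejer_weight_le1.
have split1 : Hsum M (fourier (Phi psi u)) <=
    2 * Hsum M (fourier (Phi psi T)) + 2 * Hsum M (fourier (Phi psi (fun c => u c - T c))).
  apply: Hsum_add => m m0; rewrite -(fourier_PhiD m0 si sT sB).
  by congr (fourier (Phi psi _) m); apply/funext => c; rewrite addrC subrK.
have split2 : Hsum M (fourier (Phi psi T)) <=
    2 * Hsum M (fourier (Phi psi (neg_poly N b1))) +
    2 * Hsum M (fourier (Phi psi (pos_poly N b2))).
  exact (Hsum_add M (fun m m0 => fourier_PhiD m0 si s1 s2)).
have small : Hsum M (fourier (Phi psi (fun c => u c - T c))) <=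
    2 * (\sum_(m < M) m.+1%:R) * e ^+ 2.
  by apply: Hsum_small => m m0; apply: fourier_Phi_le.
have n1 : Hsum M (fourier (Phi psi (neg_poly N b1))) <= C1 * S.
  apply: (le_trans (C1P _ _ _)); apply: ler_wpM2l => //.
  apply: le_trans (uS N); rewrite /Hsum -[leLHS]add0r; apply: lerD (Hpos_ge0 _ _) _.
  by apply: ler_sum => n _; rewrite ler_wpM2l // weight.
have n2 : Hsum M (fourier (Phi psi (pos_poly N b2))) <= C2 * S.
  apply: (le_trans (C2P _ _ _)); apply: ler_wpM2l => //.
  apply: le_trans (uS N); rewrite /Hsum -[leLHS]addr0; apply: lerD _ (Hneg_ge0 _ _).
  by apply: ler_sum => n _; rewrite ler_wpM2l // weight.
have := le_of_splittings split1 split2 small n1 n2.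
rewrite -mulrDl mulrA; congr (_ <= _ + _).
by rewrite /W; ring.
Qed.

End DiffeoBound.

(** * Norms as sums over the integers *)

Section SumsOverIntegers.
Context {R : realType}.
Implicit Types (f : int -> R) (a : int -> R[i]).
Local Notation normc := (@Normc.normc R).

Definition int_range (N : nat) : seq int :=
  (0 : int) :: [seq n.+1%:Z | n <- iota 0 N] ++ [seq - n.+1%:Z | n <- iota 0 N].

Lemma uniq_int_range N : uniq (int_range N).
Proof.
rewrite /= mem_cat negb_or cat_uniq; apply/andP; split.
  by apply/andP; split; apply/mapP => -[n _]; lia.
have posI : injective (fun n : nat => n.+1%:Z) by move=> m n; lia.
have negI : injective (fun n : nat => - n.+1%:Z) by move=> m n; lia.
rewrite (map_inj_uniq posI) (map_inj_uniq negI) iota_uniq andbT /=.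
by apply/hasPn => _ /mapP[n _ ->]; apply/mapP => -[m _]; lia.
Qed.

Lemma mem_int_range N (n : int) : (`|n| <= N)%N -> n \in int_range N.
Proof.
move=> nN; rewrite /int_range inE mem_cat; case: n nN => [[|n]|n] nN //.
  by apply/orP; right; apply/orP; left; apply/mapP; exists n; rewrite // mem_iota; lia.
apply/orP; right; apply/orP; right; apply/mapP; exists n; last by rewrite NegzE.
by rewrite mem_iota; lia.
Qed.

Lemma sum_int_range N f : \sum_(n <- int_range N) f n =
  f 0 + \sum_(n < N) f n.+1%:Z + \sum_(n < N) f (- n.+1%:Z).
Proof.
rewrite /int_range big_cons big_cat !big_map addrA.
by rewrite -(big_mkord xpredT (fun n => f n.+1%:Z))
  -(big_mkord xpredT (fun n => f (- n.+1%:Z))) /index_iota subn0.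
Qed.

Lemma esum_int_le f (B : R) : (forall n, 0 <= f n) ->
  (forall N, f 0 + \sum_(n < N) f n.+1%:Z + \sum_(n < N) f (- n.+1%:Z) <= B) ->
  (\esum_(n in [set: int]) (f n)%:E <= B%:E)%E.
Proof.
move=> f0 fB; apply: ge_ereal_sup => _ [A [finA _] <-].
rewrite fsbig_finite // sumEFin lee_fin.
have := finmap.fset_uniq (fset_set A).
set s := finmap.enum_fset (fset_set A) => us.
pose N := (\max_(x <- s) `|x|)%N.
apply: le_trans (fB N); rewrite -sum_int_range.
rewrite (perm_big [seq x <- int_range N | x \in s]); last first.
  apply: (uniq_perm us) => [|x]; first by rewrite filter_uniq ?uniq_int_range.
  rewrite mem_filter; have [xA|//] := boolP (x \in s).
  by rewrite mem_int_range // /N; apply: (leq_bigmax_seq _ xA).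
rewrite big_filter big_mkcond; apply: ler_sum => x _.
by case: ifP.
Qed.

Lemma esum_int_ge f N : 
  ((f 0 + \sum_(n < N) f n.+1%:Z + \sum_(n < N) f (- n.+1%:Z))%:E <=
   \esum_(n in [set: int]) (f n)%:E)%E.
Proof.
apply: esum_ge; exists [set` int_range N].
  by split; [exact: finite_seq|exact: subsetT].
by rewrite -fsbig_seq ?uniq_int_range // sumEFin sum_int_range.
Qed.

Lemma Hsum_weight (a : int -> R[i]) N :
  let f n := `|n|%:~R * normc (a n) ^+ 2 in
  f 0 + \sum_(n < N) f n.+1%:Z + \sum_(n < N) f (- n.+1%:Z) = Hsum N a.
Proof. by rewrite /= normr0 mul0r add0r; congr (_ + _). Qed.

Lemma sqnorm_seq_le a (B : R) : (forall N, Hsum N a <= B) -> (sqnorm_seq a <= B%:E)%E.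
Proof.
move=> aB; apply: esum_int_le => [n|N]; last by rewrite Hsum_weight.
by rewrite mulr_ge0 ?sqr_ge0 // ler0z normr_ge0.
Qed.

Lemma sqnorm_seq_ge a N : ((Hsum N a)%:E <= sqnorm_seq a)%E.
Proof. by have := esum_int_ge (fun n => `|n|%:~R * normc (a n) ^+ 2) N; rewrite Hsum_weight. Qed.

Lemma sqnorm_seq_ge0 a : (0 <= sqnorm_seq a)%E.
Proof. by apply: esum_ge0 => n _; rewrite lee_fin mulr_ge0 ?sqr_ge0 // ler0z normr_ge0. Qed.

End SumsOverIntegers.

(** * Diffeomorphisms act by symplectic operators *)

Section DiffeoSymplectic.
Context {R : realType}.
Implicit Types (psi : circle_bij R).
Local Notation normc := (@Normc.normc R).

Lemma Phi_bounded psi : Diff_circle psi -> bounded_on_H (Phi psi).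
Proof.
move=> D; have [C C0 CP] := Phi_Hsum_bound D.
(* A zero constant would annihilate an infinite norm, as 0 * +oo = 0. *)
exists (Num.sqrt (C + 1)) => u Hu; have C1 : 0 < C + 1 by rewrite ltr_wpDl.
rewrite sqr_sqrtr ?(ltW C1) //.
have := sqnorm_seq_ge0 (fourier u); rewrite /sqnorm_omega.
have uP := sqnorm_seq_ge (fourier u).
case: (sqnorm_seq (fourier u)) uP => [S uS S0|_ _|_]; last by [].
- apply: sqnorm_seq_le => M.
  have S0' : 0 <= S by rewrite -lee_fin.
  apply: (le_trans (CP u Hu S _ M)); last by rewrite mulrDl mul1r lerDl.
  by move=> N; rewrite -lee_fin.
- by rewrite mulry gtr0_sg // mul1e leey.
Qed.

Lemma fourier_Phi_onb psi (n m : int) : m != 0 -> smooth_map (cb_inv psi) ->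
  fourier (Phi psi (onb n)) m =
  ((Num.sqrt (`|n|%:~R : R))^-1)%:C * fourier (Phi psi (expz n)) m.
Proof.
move=> m0 si; set r := (_^-1)%:C.
have so : smooth_fun (@onb R n) := smooth_scale_expz r n.
have se := @smooth_expz R n.
rewrite (fourier_Phi m0 si so) (fourier_Phi m0 si se).
rewrite -(avgZ _ (smooth_fcoef _ (smooth_pullback si se))).
by congr avg; apply/funext => t; rewrite mulrA.
Qed.

Lemma Phi_HS psi : Diff_circle psi -> (sqnorm_HS (Phi psi) < +oo)%E.
Proof.
move=> D; have [K K0 KP] := Phi_expz_decay D; have [_ si _] := D.
pose F (n : nat) : R := K ^+ 2 * ((n.+1%:R ^+ 2)^-1 * 2).
have F0 n : 0 <= F n by rewrite !mulr_ge0 ?invr_ge0 ?sqr_ge0.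
have inner n : (sqnorm_seq (proj_pos (fourier (Phi psi (onb (- n.+1%:Z))))) <= (F n)%:E)%E.
  apply: sqnorm_seq_le => M; rewrite /Hsum /Hneg big1 ?addr0 => [|m _]; last first.
    by rewrite /proj_pos (_ : (0 < - m.+1%:Z) = false) // Normc.normc0 expr0n mulr0.
  apply: (@le_trans _ _ (\sum_(m < M) K ^+ 2 * ((n.+1%:R ^+ 2)^-1 * (m.+1%:R ^+ 2)^-1))).
    apply: ler_sum => m _; rewrite /proj_pos (_ : (0 < m.+1%:Z) = true) //.
    pose r : R := (Num.sqrt (`|- n.+1%:Z|%:~R : R))^-1.
    have r2 : r ^+ 2 = n.+1%:R^-1.
      by rewrite exprVn sqr_sqrtr ?normrN.
    rewrite (fourier_Phi_onb _ (isT : m.+1%:Z != 0) si) -/r.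
    rewrite Normc.normcM exprMn normc_real real_normK ?num_real // r2.
    rewrite [_^-1 * _ ^+ 2]mulrC [(n.+1%:R ^+ 2)^-1 * _]mulrC.
    by apply: decay_weight; rewrite normc_ge0 KP.
  rewrite -mulr_sumr -mulr_sumr; apply: ler_wpM2l; first exact: sqr_ge0.
  by apply: ler_wpM2l (sum_inv_sqr_le2 M); rewrite invr_ge0 sqr_ge0.
pose G (n : int) : R := if n is Negz k then F k else 0.
have GF k : G (- k.+1%:Z) = F k by rewrite -NegzE.
apply: (@le_lt_trans _ _ (\esum_(n in [set: int]) (G n)%:E)%E).
  rewrite /sqnorm_HS esum_mkcond; apply: le_esum => n _.
  case: n => n; first by rewrite memNset //= lee_fin.
  by rewrite mem_set //; have := inner n; rewrite -NegzE.
apply: (@le_lt_trans _ _ (K ^+ 2 * (2 * 2))%:E); last exact: ltry.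
apply: esum_int_le => [[]|N] //.
have -> : G 0 + \sum_(n < N) G n.+1%:Z + \sum_(n < N) G (- n.+1%:Z) = \sum_(n < N) F n.
  by rewrite add0r big1 ?add0r //; apply: eq_bigr => n _; exact: GF.
rewrite -mulr_sumr -mulr_suml; apply: ler_wpM2l; first exact: sqr_ge0.
by apply: ler_wpM2r (sum_inv_sqr_le2 N).
Qed.

Theorem Phi_Sp_infty psi : Diff_circle psi -> Sp_infty (Phi psi).
Proof.
move=> D; have [sp si _] := D; split; split.
- exact: Phi_bij.
- exact: Phi_linear.
- exact: Phi_bounded.
- exact: Phi_conj.
- exact: omega_Phi.
- exact: Phi_HS.
Qed.

End DiffeoSymplectic.

(** * Injectivity *)

Section InjectiveNotSurjective.
Context {R : realType}.
Implicit Types (u v : circle R -> R[i]) (psi : circle_bij R) (z w : R[i]).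
Local Notation Re := (@complex.Re R).
Local Notation Im := (@complex.Im R).
Local Notation normc := (@Normc.normc R).

(** The equations at the antipodal points 1 and -1 add up to |c|^2 = 0. *)
Lemma circle_translation (c : R[i]) :
  (forall d : circle R, normc (val d + c) = 1) -> c = 0.
Proof.
move=> H; have e1 := H (cis 0); have e2 := H (cis pi).
have := normc_sqr (val (cis 0) + c); have := normc_sqr (val (cis pi) + c).
rewrite e1 e2 !ReImE /= cos0 sin0 cospi sinpi !expr1n.
case: c {H e1 e2} => x y /= h1 h2.
have h : x ^+ 2 + y ^+ 2 = 0 by lra.
have : (x ^+ 2 == 0) && (y ^+ 2 == 0).
  by rewrite -paddr_eq0 ?sqr_ge0 // h.
by rewrite !sqrf_eq0 => /andP[/eqP -> /eqP ->].
Qed.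

(** The image of e^(i theta) under Phi psi is psi^-1 minus a constant, so the two
    inverses differ by a translation. *)
Lemma cb_inv_eq_of_Phi psi1 psi2 : Phi psi1 (expz 1) = Phi psi2 (expz 1) ->
  cb_inv psi1 =1 cb_inv psi2.
Proof.
move=> e; pose a psi : R[i] := avg (fun t => expz 1 (cb_inv psi (cis t))).
have PE psi d : Phi psi (expz 1) d = val (cb_inv psi d) - a psi.
  exact (congr1 (fun x => x - a psi) (expr1z _)).
have E d : val (cb_inv psi1 d) = val (cb_inv psi2 d) + (a psi1 - a psi2).
  have := PE psi1 d; rewrite e PE => H.
  by rewrite -[LHS](subrK (a psi1)) -H -addrA [- _ + _]addrC.
have a0 : a psi1 - a psi2 = 0.
  by apply: circle_translation => d; rewrite -(cb_funK psi2 d) -E; exact: normc_circle.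
by move=> d; apply: val_inj; rewrite E a0 addr0.
Qed.

Lemma Phi_inj psi1 psi2 : eq_on_H (Phi psi1) (Phi psi2) -> psi1 =1 psi2.
Proof.
move=> /(_ _ (@Hspace_expz R 1 isT)) /cb_inv_eq_of_Phi e d.
by rewrite -{1}(cb_funK psi2 d) -e cb_invK.
Qed.

(** * A symplectic operator that does not come from a diffeomorphism *)

(** The reflection u |-> - u on the modes of frequency 2 and -2. Reversing both
    modes keeps the operator real and symplectic, and being diagonal it has
    no off-diagonal block. *)
Definition flip2 : operator R := fun u c =>
  u c + (- 2 * fourier u 2) * expz 2 c + (- 2 * fourier u (- 2)) * expz (- 2) c.

Lemma smooth_flip2 u : smooth_fun u -> smooth_fun (flip2 u).
Proof.
move=> su; have s1 := @smooth_scale_expz R (- 2 * fourier u 2) 2.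
have s2 := @smooth_scale_expz R (- 2 * fourier u (- 2)) (- 2).
exact (smoothC_add (smoothC_add su s1) s2).
Qed.

Lemma Hspace_flip2 u : Hspace u -> Hspace (flip2 u).
Proof.
move=> Hu; have H1 : Hspace (@expz R 2) := @Hspace_expz R 2 isT.
have H2 : Hspace (@expz R (- 2)) := @Hspace_expz R (- 2) isT.
exact (HspaceD (HspaceD Hu (HspaceZ (- 2 * fourier u 2) H1))
  (HspaceZ (- 2 * fourier u (- 2)) H2)).
Qed.

Lemma fourier_flip2 u n : smooth_fun u -> fourier (flip2 u) n =
  (if (n == 2) || (n == - 2) then -1 else 1) * fourier u n.
Proof.
move=> su; have s1 := @smooth_scale_expz R (- 2 * fourier u 2) 2.
have s2 := @smooth_scale_expz R (- 2 * fourier u (- 2)) (- 2).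
have su1 : smooth_fun (fun c => u c + (- 2 * fourier u 2) * expz 2 c) := smoothC_add su s1.
rewrite /flip2 (fourierD n su1 s2) (fourierD n su s1).
rewrite (fourierZ _ n (@smooth_expz R 2)) (fourierZ _ n (@smooth_expz R (- 2))) !fourier_expz.
rewrite ![_ == n]eq_sym.
have [->|n2] := eqVneq n 2; first by rewrite /=; ring.
have [->|n3] := eqVneq n (- 2); first by rewrite /=; ring.
by rewrite /= !mulr0 !addr0 mul1r.
Qed.

Lemma flip2K u : smooth_fun u -> flip2 (flip2 u) = u.
Proof.
move=> su; apply/funext => c; rewrite {1}/flip2 !fourier_flip2 // /flip2 /=; ring.
Qed.

Lemma flip2_linear : linear_on_H flip2.
Proof.
move=> z u v [su _] [sv _]; apply/funext => c.
have szu : smooth_fun (fun c => z * u c) := smoothC_mul (smoothC_cst z) su.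
by rewrite /flip2 !(fourierD _ szu sv) !(fourierZ z _ su); ring.
Qed.

Lemma flip2_sqnorm u : smooth_fun u -> sqnorm_omega (flip2 u) = sqnorm_omega u.
Proof.
move=> su; apply: eq_esum => n _; rewrite fourier_flip2 // Normc.normcM.
by case: ifP => _; rewrite ?normcN Normc.normc1 mul1r.
Qed.

Lemma flip2_conj : eq_on_H flip2 (conj_op flip2).
Proof.
move=> u [su _]; apply/funext => c; rewrite /conj_op /flip2 !fourier_conj //.
rewrite /conj_fun !conjcD !(conjcM (- 2 * _)) !(conjcM (- 2)) !conjcK opprK.
have exc (k : int) : (expz k c)^* = expz (- k) c.
  by have [t _ <-] := cis_surj c; rewrite !expz_cis -expiN mulrNz mulNr.
have c2 : (- 2 : R[i])^* = - 2 by apply: complexP; rewrite ReImE /= ?oppr0 //; ring.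
by rewrite c2 !exc opprK addrAC.
Qed.

Lemma omega_addl u v z n : smooth_fun u -> smooth_fun v ->
  omega (fun c => u c + z * expz n c) v = omega u v + z * omega (expz n) v.
Proof.
move=> su sv; have sv' := smoothC_deriveC sv.
have s1 := smoothC_mul su sv'; have s2 := smoothC_mul (@smooth_expz R n) sv'.
rewrite /omega -(avgZ _ s2) -(avgD s1 (smoothC_mul (smoothC_cst z) s2)).
by congr avg; apply/funext => t; rewrite mulrDl mulrA.
Qed.

Lemma omega_addr u v z n : smooth_fun u -> smooth_fun v ->
  omega u (fun c => v c + z * expz n c) = omega u v + z * omega u (expz n).
Proof.
move=> su sv; have se := @smooth_expz R n.
have s1 := smoothC_mul su (smoothC_deriveC sv).
have s2 := smoothC_mul su (smoothC_deriveC se).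
rewrite /omega -(avgZ _ s2) -(avgD s1 (smoothC_mul (smoothC_cst z) s2)).
have -> : (fun c => v c + z * expz n c) \o cis =
  (fun t => (v \o cis) t + z * (expz n \o cis) t) by [].
rewrite (deriveC_add sv (smoothC_mul (smoothC_cst z) se)) (deriveC_scale z se).
by congr avg; apply/funext => t; rewrite mulrDr [in RHS]mulrCA.
Qed.

Lemma omega_expzr u n : smooth_fun u ->
  omega u (expz n) = 'i * (n%:~R)%:C * fourier u (- n).
Proof.
move=> su; rewrite /omega expz_cisE deriveC_expi_linear fourier_fcoef.
rewrite -(avgZ _ (smooth_fcoef _ su)) opprK.
by congr avg; apply/funext => t; rewrite mulrCA.
Qed.

Lemma omega_expzl v n : smooth_fun v ->
  omega (expz n) v = - ('i * (n%:~R)%:C * fourier v (- n)).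
Proof.
move=> sv; rewrite fourier_fcoef -mulNr -mulrN -rmorphN -mulrNz.
rewrite -(fcoef_deriveC _ sv (per_cis v)) /fcoef /omega; congr avg.
by apply/funext => t; rewrite expz_cis mulrC opprK.
Qed.

Lemma omega_flip2 u v : Hspace u -> Hspace v -> omega (flip2 u) (flip2 v) = omega u v.
Proof.
move=> [su _] [sv _]; have sFv := smooth_flip2 sv.
have su1 : smooth_fun (fun c => u c + (- 2 * fourier u 2) * expz 2 c).
  have s1 := @smooth_scale_expz R (- 2 * fourier u 2) 2; exact (smoothC_add su s1).
have sv1 : smooth_fun (fun c => v c + (- 2 * fourier v 2) * expz 2 c).
  have s1 := @smooth_scale_expz R (- 2 * fourier v 2) 2; exact (smoothC_add sv s1).
rewrite [LHS](omega_addl (- 2 * fourier u (- 2)) (- 2) su1 sFv).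
rewrite (omega_addl (- 2 * fourier u 2) 2 su sFv) !(omega_expzl _ sFv).
rewrite !(fourier_flip2 _ sv).
rewrite [omega u (flip2 v)](omega_addr (- 2 * fourier v (- 2)) (- 2) su sv1).
rewrite (omega_addr (- 2 * fourier v 2) 2 su sv) !(omega_expzr _ su) /= opprK.
rewrite (_ : ((-2)%:~R)%:C = - (2%:~R)%:C :> R[i]); last by rewrite -rmorphN -mulrNz.
ring.
Qed.

Lemma flip2_Sp_infty : Sp_infty flip2.
Proof.
split; split.
- split.
  + by move=> u; exact: Hspace_flip2.
  + by move=> u v /set_mem[su _] /set_mem[sv _] /(congr1 flip2); rewrite !flip2K.
  + move=> u Hu; exists (flip2 u); first exact: Hspace_flip2.
    by case: Hu => su _; exact: flip2K.
- exact: flip2_linear.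
- by exists 1 => u [su _]; rewrite flip2_sqnorm // expr1n mul1e.
- exact: flip2_conj.
- exact: omega_flip2.
- rewrite /sqnorm_HS esum1 ?ltry // => n n0; apply: esum1 => m _.
  rewrite /proj_pos; case: ifP => m0; last by rewrite Normc.normc0 expr0n mulr0.
  pose r : R[i] := ((Num.sqrt (`|n|%:~R : R))^-1)%:C.
  have so : smooth_fun (onb n) := smooth_scale_expz r n.
  rewrite (fourier_flip2 m so) [fourier (onb n) m](fourierZ r m (@smooth_expz R n)).
  rewrite fourier_expz.
  rewrite (_ : n == m = false) ?mulr0 ?Normc.normc0 ?expr0n ?mulr0 //.
  by apply/eqP => nm; move: n0 m0; rewrite /= nm => /lt_trans /[apply]; rewrite ltxx.
Qed.

(** As flip2 fixes e^(i theta), which determines psi, the diffeomorphism would be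
    the identity; but flip2 reverses e^(2 i theta). *)
Lemma flip2_not_Phi psi : ~ eq_on_H (Phi psi) flip2.
Proof.
move=> e; pose idb := @CircleBij R id id (fun=> erefl) (fun=> erefl).
have H1 : Hspace (@expz R 1) := @Hspace_expz R 1 isT.
have H2 : Hspace (@expz R 2) := @Hspace_expz R 2 isT.
have fix1 : flip2 (expz 1) = expz 1.
  by apply/funext => c; rewrite /flip2 !fourier_expz /= !mulr0 !mul0r !addr0.
have pid : cb_inv psi =1 id.
  apply: (@cb_inv_eq_of_Phi psi idb).
  by rewrite (e _ H1) fix1 (Phi_id (psi := idb) (fun=> erefl) H1).
have := e _ H2; rewrite (Phi_id pid H2) => /(congr1 (fun f => f (cis 0))).
rewrite /flip2 !fourier_expz /= !expz_cis mulr0 expi0.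
by move/(congr1 Re); rewrite !ReImE /=; lra.
Qed.

End InjectiveNotSurjective.

(** * The representation *)

Theorem theorem4p6 (R : realType) :
  [/\ (forall psi : circle_bij R, Diff_circle psi -> Sp_infty (Phi psi)),
      (forall psi1 psi2 : circle_bij R, Diff_circle psi1 -> Diff_circle psi2 ->
         eq_on_H (Phi (circle_bij_comp psi1 psi2)) (fun u => Phi psi1 (Phi psi2 u))),
      (forall psi1 psi2 : circle_bij R, Diff_circle psi1 -> Diff_circle psi2 ->
         eq_on_H (Phi psi1) (Phi psi2) -> psi1 =1 psi2)
    & ~ (forall A : operator R, Sp_infty A ->
           exists2 psi : circle_bij R, Diff_circle psi & eq_on_H (Phi psi) A)].
Proof.
split.
- exact: Phi_Sp_infty.
- by move=> psi1 psi2 [_ s1 _] [_ s2 _]; exact: Phi_comp.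
- by move=> psi1 psi2 _ _; exact: Phi_inj.
- by move=> /(_ _ flip2_Sp_infty)[psi _]; exact: flip2_not_Phi.
Qed.
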